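(* Let $d\ge 2$ and let $p=a/b>0$, with $a,b$ coprime positive integers. (1) For every $\mu\in\mathcal M_p$, there exists $\nu\in\mathcal M_p$ with $\operatorname{supp}\nu\subseteq\operatorname{supp}\mu$ and $$\#\operatorname{supp}\nu\le R_{d,a},\qquad R_{d,a}=\begin{cases}D_a,&a\text{ even},\\ D_{2a},&a\text{ odd},\end{cases}\qquad D_m=\binom{d+m-1}{m}.$$ Moreover, the potentials of $\mu$ and $\nu$ agree on $\operatorname{supp}\mu$, i.e. $F_{p,\mu}(x)=F_{p,\nu}(x)$ for all $x\in\operatorname{supp}\mu$. (2) If $S\subseteq\mathbb S^{d-1}$ is an infinite compact set such that the restriction to $S\times S$ of the kernel $(x,y)\mapsto|x\cdot y|^{a/b}$ is positive semidefinite, then $b<d$. Consequently, if $b\ge d$, every member of $\mathcal M_p$ has finite support.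
   Context: $\mathbb S^{d-1}$ is the real unit sphere in $\mathbb R^d$, and $\mathcal P(\mathbb S^{d-1})$ is the set of Borel probability measures on it. For $p>0$ and $\mu\in\mathcal P(\mathbb S^{d-1})$, $$I_p(\mu)=\iint_{\mathbb S^{d-1}\times\mathbb S^{d-1}}|x\cdot y|^p\,d\mu(x)\,d\mu(y),\qquad e(p)=\min_{\mu\in\mathcal P(\mathbb S^{d-1})}I_p(\mu),\qquad \mathcal M_p=\{\mu\in\mathcal P(\mathbb S^{d-1}):I_p(\mu)=e(p)\}.$$ The potential of $\mu$ is $F_{p,\mu}(x)=\int|x\cdot y|^p\,d\mu(y)$, $x\in\mathbb S^{d-1}$. A real symmetric kernel $K$ on a set $S$ is positive semidefinite if $\sum_{i,j}c_ic_jK(x_i,x_j)\ge0$ for all finite families $x_i\in S$, $c_i\in\mathbb R$. Cardinalities of supports count points of the sphere (antipodal points count separately). *)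

(* Defs.v *)
From HB Require Import structures.
From mathcomp Require Import all_boot all_order all_algebra.
From mathcomp Require Import all_classical all_reals all_analysis.

Set Implicit Arguments.
Unset Strict Implicit.
Unset Printing Implicit Defensive.

Import Order.TTheory GRing.Theory Num.Theory.
Import numFieldNormedType.Exports.

Local Open Scope classical_set_scope.
Local Open Scope ring_scope.

(* R^d is 'rV[R]_d.  The library norms it with the sup norm, so the Euclidean
   inner product is introduced below; the topology is the usual one. *)

Notation borelRn R d := (g_sigma_algebraType (@open 'rV[R]_d)).

Definition dot (R : realType) (d : nat) (x y : 'rV[R]_d) : R :=
  \sum_(i < d) x ord0 i * y ord0 i.

Definition unit_sphere (R : realType) (d : nat) : set 'rV[R]_d :=
  [set x | dot x x = 1].

(* A Borel probability measure on the sphere is represented by its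
   push-forward under the inclusion in R^d, that is, by a Borel probability
   measure on R^d that gives mass 1 to the (closed) sphere. *)
Definition sphere_prob (R : realType) (d : nat) :
    set (probability (borelRn R d) R) :=
  [set mu | mu (@unit_sphere R d) = 1%E].

(* As the sphere is closed, for mu in sphere_prob this is also the support
   of mu as a measure on the sphere. *)
Definition supp (R : realType) (d : nat) (mu : probability (borelRn R d) R) :
    set 'rV[R]_d :=
  [set x | forall U : set 'rV[R]_d, open U -> U x -> (0 < mu U)%E].

(* For p > 0 the library's real power satisfies 0 `^ p = 0. *)
Definition kernel_p (R : realType) (d : nat) (p : R) (x y : 'rV[R]_d) : R :=
  `|dot x y| `^ p.

Definition energy (R : realType) (d : nat) (p : R)
    (mu : probability (borelRn R d) R) : \bar R :=
  (\int[mu]_(y in @unit_sphere R d)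
     \int[mu]_(x in @unit_sphere R d) (kernel_p p x y)%:E)%E.

Definition min_energy (R : realType) (d : nat) (p : R) : \bar R :=
  ereal_inf [set energy p mu | mu in @sphere_prob R d].

Definition minimizers (R : realType) (d : nat) (p : R) :
    set (probability (borelRn R d) R) :=
  [set mu | @sphere_prob R d mu /\ energy p mu = min_energy d p].

Definition potential (R : realType) (d : nat) (p : R)
    (mu : probability (borelRn R d) R) (x : 'rV[R]_d) : \bar R :=
  (\int[mu]_(y in @unit_sphere R d) (kernel_p p x y)%:E)%E.

Definition psd_kernel_on (R : realType) (T : Type) (S : set T)
    (K : T -> T -> R) : Prop :=
  (forall x y : T, S x -> S y -> K x y = K y x) /\
  (forall (n : nat) (x : 'I_n -> T) (c : 'I_n -> R),
     (forall i, S (x i)) ->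
     0 <= \sum_(i < n) \sum_(j < n) c i * c j * K (x i) (x j)).

Definition dim_D (d m : nat) : nat := 'C(d + m - 1, m)%N.

Definition bound_R (d a : nat) : nat :=
  if odd a then dim_D d (2 * a) else dim_D d a.

(* Main.v *)
(** Write [K x y] for the [p]-th power of [|x . y|].  At a minimizer [mu] the first
    variation makes the potential constant on [supp mu], and the second one makes [K]
    positive semidefinite there.  The entrywise power [K ^ b] (or [K ^ 2b] if [a] is odd)
    is the polynomial kernel [(x . y) ^ a] (or [(x . y) ^ 2a]), whose rank is at most
    [bound_R d a]; by the strict Schur product theorem, a Gram matrix of [K] on more points
    of the support is singular.  Moving the weights along a kernel vector
    removes a point without raising the energy, so the best configuration of at most
    [bound_R d a] points of [supp mu] is not improved by adding a point of [supp mu]: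
    its potential is at least its energy on [supp mu].  It is the measure [nu], and
    integrating against [mu] forces equality.

    For the second part, let [S] be infinite and suppose [b >= d].  The rank of [K] on [S]
    is finite, so the functions [f_y = K(., y)] span a finite-dimensional space, while
    [f_y ^ 2b = h_y ^ 2a] for the linear forms [h_y = (. , y)].  The ultrapower of the reals
    along a free ultrafilter on [S] contains a generic point of [S], and carries a derivation
    [D] that kills the constants but not that point.  Exponentiating [D] turns [f_y] and [h_y],
    evaluated at the generic point, into power series; with [y] made generic too, their
    coefficients satisfy linear recursions over the first ultrapower: those of [h] are
    combinations of the first [d].  Given a valuation ring over that field, normalize both
    series: their reductions have orders [j] and [k < d] with [b j = a k], so that [b] divides
    [k] and [k = 0].  Hence [D h_y / h_y] lies in every such valuation ring and is therefore
    algebraic over the first ultrapower, that is, it has the same value [c] for almost all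
    [y].  Then [D x = c x] for the generic point [x], and [x . x = 1] gives [D x = 0]. *)

Require Import Defs.
From HB Require Import structures.
From mathcomp Require Import all_boot all_order all_algebra.
From mathcomp Require Import finmap.
From mathcomp Require Import all_classical all_reals all_analysis.
From mathcomp Require Import measurable_realfun.
From mathcomp Require Import ring lra zify.
Import Order.TTheory GRing.Theory Num.Theory.
Import numFieldNormedType.Exports.
Local Open Scope classical_set_scope.
Local Open Scope ring_scope.

Set Implicit Arguments.
Unset Strict Implicit.
Unset Printing Implicit Defensive.

(** * Positive semidefinite matrices *)

Section QuadraticForms.
Variable R : realType.

Definition qform (I : finType) (G : I -> I -> R) (c : I -> R) : R :=
  \sum_i \sum_j c i * c j * G i j.

(** Cholesky factorization by induction on [n]: the last index is eliminated by its Schur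
    complement. Indexing by [nat] spares the reindexing of matrices. *)
Lemma qform_nat_psd_gram n (G : nat -> nat -> R) :
  (forall i j, G i j = G j i) ->
  (forall c : nat -> R, 0 <= \sum_(i < n) \sum_(j < n) c i * c j * G i j) ->
  exists B : nat -> nat -> R, forall i j, (i < n)%N -> (j < n)%N ->
    G i j = \sum_(k < n) B k i * B k j.
Proof.
elim: n G => [|n IH] G symG psdG; first by exists (fun _ _ => 0).
have step (c : nat -> R) t : \sum_(i < n.+1) \sum_(j < n.+1)
    (if i == n :> nat then t else c i) * (if j == n :> nat then t else c j) * G i j =
    \sum_(i < n) \sum_(j < n) c i * c j * G i j
      + 2 * t * (\sum_(j < n) c j * G n j) + t ^+ 2 * G n n.
  rewrite big_ord_recr /= eqxx big_ord_recr /= eqxx.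
  under eq_bigr => i _.
    rewrite big_ord_recr /= eqxx (ltn_eqF (ltn_ord i)).
    under eq_bigr => j _ do rewrite (ltn_eqF (ltn_ord j)).
    over.
  rewrite big_split /=.
  under [X in _ + (X + _) = _]eq_bigr => j _ do rewrite (ltn_eqF (ltn_ord j)).
  have -> : \sum_(i < n) c i * t * G i n = t * \sum_(j < n) c j * G n j.
    by rewrite mulr_sumr; apply: eq_bigr => i _; rewrite symG; ring.
  have -> : \sum_(j < n) t * c j * G n j = t * \sum_(j < n) c j * G n j.
    by rewrite mulr_sumr; apply: eq_bigr => i _; ring.
  ring.
set g := G n n.
have g0 : 0 <= g.
  have := psdG (fun i => if i == n then 1 else 0); rewrite (step (fun=> 0) 1).
  rewrite big1 ?add0r => [|i _]; last by rewrite big1// => j _; rewrite !mul0r.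
  by rewrite big1 ?mulr0 ?add0r ?expr1n ?mul1r// => j _; rewrite mul0r.
(* A zero pivot has a zero row: otherwise this [t] would make the form, here
   [G i i + 2 * t * G n i], equal to [-1]. *)
have gz i : (i < n)%N -> g = 0 -> G n i = 0.
  move=> ilt gz; apply: contrapT => /eqP Gni.
  pose t := - (G i i + 1) / (2 * G n i).
  have := psdG (fun j => if j == n then t else (j == i)%:R).
  rewrite (step (fun j => (j == i)%:R) t) -/g gz mulr0 addr0.
  have dsum (f : nat -> R) : \sum_(j < n) (j == i :> nat)%:R * f j = f i.
    rewrite (bigD1 (Ordinal ilt))//= eqxx mul1r big1 ?addr0// => j.
    by rewrite -val_eqE /= => /negbTE ->; rewrite mul0r.
  have -> : \sum_(l < n) \sum_(j < n) (l == i :> nat)%:R * (j == i :> nat)%:R * G l j = G i i.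
    rewrite -[RHS](dsum (fun l => G l i)); apply: eq_bigr => l _.
    by rewrite -(dsum (G l)) mulr_sumr; apply: eq_bigr => j _; rewrite mulrA.
  rewrite dsum /t; have -> : 2 * (- (G i i + 1) / (2 * G n i)) * G n i = - (G i i + 1) by field.
  lra.
(* The Schur complement. If [g = 0], division by zero makes it [G] itself, in accordance with the
   vanishing of row [n]. *)
pose G' i j := G i j - G n i * G n j / g.
have [||B BE] := IH G'.
- by move=> i j; rewrite /G' symG [G n i * _]mulrC.
- move=> c; pose s := \sum_(j < n) c j * G n j.
  (* For [g != 0] the weight [- s / g] of the last index minimizes the form, and the minimum is the
     form of the Schur complement. *)
  have := psdG (fun i => if i == n then - s / g else c i); rewrite step -/g -/s.
  have -> : \sum_(i < n) \sum_(j < n) c i * c j * G' i j =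
      \sum_(i < n) \sum_(j < n) c i * c j * G i j - s * s / g.
    rewrite /s mulr_suml mulr_suml -sumrB; apply: eq_bigr => i _.
    rewrite mulr_sumr mulr_suml -sumrB; apply: eq_bigr => j _; rewrite /G'; ring.
  have [->|gN0] := eqVneq g 0; first by rewrite invr0 !mulr0 !mul0r !addr0 subr0.
  by congr (0 <= _); field.
exists (fun k i => if k == n then G n i / Num.sqrt g else if i == n then 0 else B k i).
move=> i j; rewrite !ltnS => ilt jlt.
rewrite big_ord_recr /= eqxx.
under eq_bigr => k _ do rewrite (ltn_eqF (ltn_ord k)).
have last : G n i / Num.sqrt g * (G n j / Num.sqrt g) = G n i * G n j / g.
  by rewrite mulrACA -invfM -expr2 sqr_sqrtr.
have Gn l : (l <= n)%N -> G n l = G n l * g / g.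
  move=> ln; have [gz0|gN0] := eqVneq g 0; last by rewrite mulfK.
  move: ln; rewrite leq_eqVlt => /orP[/eqP ->|ln]; last by rewrite gz// !mul0r.
  by rewrite -/g gz0 !mul0r.
rewrite last.
have [->|iN] := eqVneq i n.
  rewrite big1 ?add0r => [|k _]; last by rewrite mul0r.
  by rewrite -/g [g * _]mulrC -Gn.
have [->|jN] := eqVneq j n.
  by rewrite big1 ?add0r => [|k _]; rewrite ?mulr0// -Gn// symG.
rewrite -BE /G' ?ltn_neqAle ?iN ?jN//; ring.
Qed.

(** The dimension [T] is left free, so that entrywise products stay in the class: the vectors are
    tensored. *)
Definition is_gram (I : Type) (G : I -> I -> R) : Prop :=
  exists (T : finType) (B : T -> I -> R), forall i j, G i j = \sum_t B t i * B t j.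

Lemma psd_gram n (G : 'I_n -> 'I_n -> R) :
  (forall i j, G i j = G j i) -> (forall c, 0 <= qform G c) -> is_gram G.
Proof.
case: n G => [|n] G symG psdG; first by exists void, (fun _ _ => 0) => -[].
have [||B BE] := @qform_nat_psd_gram n.+1 (fun i j => G (inord i) (inord j)).
- by move=> i j; exact: symG.
- move=> c; have := psdG (fun i => c i); congr (0 <= _).
  by apply: eq_bigr => i _; apply: eq_bigr => j _; rewrite !inord_val.
exists 'I_n.+1, (fun (k i : 'I_n.+1) => B k i) => i j.
by rewrite -BE // !inord_val.
Qed.

Lemma is_gram1 (I : Type) : is_gram (fun _ _ : I => 1).
Proof. by exists 'I_1, (fun _ _ => 1) => i j; rewrite big_ord1 mulr1. Qed.

Lemma is_gramM (I : Type) (G H : I -> I -> R) :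
  is_gram G -> is_gram H -> is_gram (fun i j => G i j * H i j).
Proof.
move=> [T [B BE]] [T' [B' BE']].
exists (T * T')%type, (fun t i => B t.1 i * B' t.2 i) => i j.
rewrite BE BE' big_distrlr pair_big /=; apply: eq_bigr => t _; ring.
Qed.

Lemma is_gramX (I : Type) (G : I -> I -> R) m : is_gram G -> is_gram (fun i j => G i j ^+ m).
Proof.
move=> gG; elim: m => [|m IH]; first exact: is_gram1.
have [T [B BE]] := is_gramM gG IH.
by exists T, B => i j; rewrite exprS BE.
Qed.

(* Strict form of the Schur product theorem, in contrapositive form. *)
Lemma schur_degenerate (I : finType) (G L : I -> I -> R) (c : I -> R) :
  (forall c, 0 <= qform G c) -> is_gram L -> (forall i, L i i != 0) ->
  (exists i, c i != 0) -> qform (fun i j => G i j * L i j) c = 0 ->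
  exists2 c', (exists i, c' i != 0) & qform G c' = 0.
Proof.
move=> psdG [T [B BE]] L0 [i ci] Qc.
(* The form of the product splits, along the Gram vectors of [L], into nonnegative forms of [G], so
   each of them vanishes. *)
have : \sum_t qform G (fun i => c i * B t i) = 0.
  rewrite -[RHS]Qc /qform exchange_big; apply: eq_bigr => k _.
  rewrite exchange_big; apply: eq_bigr => l _.
  rewrite BE !mulr_sumr; apply: eq_bigr => t _; ring.
move=> /eqP; rewrite psumr_eq0// => /allP Qt.
have [t Bti] : exists t, B t i != 0.
  apply: contrapT => nex; move: (L0 i); rewrite BE big1 ?eqxx// => t _.
  by have [->|Bti] := eqVneq (B t i) 0; [rewrite mul0r|case: nex; exists t].
exists (fun i => c i * B t i); first by exists i; rewrite mulf_neq0.
by apply/eqP; exact: (Qt t (mem_index_enum t)).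
Qed.

(** The power is the product of [G] with its power of exponent [m - 1], a Gram matrix with nonzero
    diagonal. *)
Lemma hadamard_power_degenerate n (G : 'I_n -> 'I_n -> R) m (c : 'I_n -> R) :
  (0 < m)%N -> (forall i j, G i j = G j i) -> (forall c, 0 <= qform G c) ->
  (forall i, G i i != 0) ->
  (exists i, c i != 0) -> qform (fun i j => G i j ^+ m) c = 0 ->
  exists2 c', (exists i, c' i != 0) & qform G c' = 0.
Proof.
case: m => // m _ symG psdG G0 c0 Qc.
apply: (schur_degenerate psdG (is_gramX m (psd_gram symG psdG)) _ c0).
  by move=> i; rewrite expf_neq0.
by rewrite -[RHS]Qc; apply: eq_bigr => i _; apply: eq_bigr => j _; rewrite exprS.
Qed.

Lemma underdetermined_system (I : finType) (A : {set I}) n (B : I -> 'I_n -> R) :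
  (#|A| < n)%N -> exists2 c : 'I_n -> R, (exists i, c i != 0) &
    forall t, t \in A -> \sum_i c i * B t i = 0.
Proof.
move=> An; pose M := \matrix_(i < n, s < #|A|) B (enum_val s) i.
have kM : kermx M != 0.
  rewrite kermx_eq0 /row_free; apply/negP => /eqP rM.
  by have := rank_leq_col M; rewrite rM leqNgt An.
exists (fun i => nz_row (kermx M) 0 i).
  apply: contrapT => nex; move: kM; rewrite -nz_row_eq0 => /eqP; apply.
  apply/rowP => i; rewrite mxE; apply: contrapT => /eqP ci; apply: nex; by exists i.
move=> t tA.
have : (nz_row (kermx M) <= kermx M)%MS by exact: nz_row_sub.
move/sub_kermxP => /matrixP/(_ 0 (enum_rank_in tA t)); rewrite !mxE => {2}<-.
by apply: eq_bigr => i _; rewrite !mxE enum_rankK_in.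
Qed.

(** The power of [dot] is a sum of products of a degree [M] monomial in [x] and the same one in [y],
    and there are [dim_D d M] monomials. With more points than monomials, some weight vector
    annihilates all of them. *)
Lemma dot_power_degenerate d M n (x : 'I_n -> 'rV[R]_d) : (0 < d)%N ->
  (dim_D d M < n)%N -> exists2 c : 'I_n -> R, (exists i, c i != 0) &
    qform (fun i j => dot (x i) (x j) ^+ M) c = 0.
Proof.
case: d x => // d x _.
rewrite /dim_D addSn subn1 /= -bin_sub ?leq_addl// addnK => dn.
pose A := [set t : d.+1.-tuple 'I_M.+1 | (\sum_(i <- t) i == M)%N]%SET.
have cardA : #|A| = 'C(d + M, d) by exact: card_ord_partitions.
pose mon (t : d.+1.-tuple 'I_M.+1) i := \prod_(l < d.+1) x i ord0 l ^+ tnth t l.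
have [|c c0 cA] := @underdetermined_system _ A n mon; first by rewrite cardA.
exists c => //.
(* The exponents of the monomial obtained by choosing coordinate [f k] in the [k]-th factor of the
   power. *)
pose cnt (f : {ffun 'I_M -> 'I_d.+1}) := [tuple (inord #|[pred k | f k == l]| : 'I_M.+1) | l < d.+1].
have cntE f l : tnth (cnt f) l = #|[pred k | f k == l]| :> nat.
  by rewrite tnth_mktuple inordK// ltnS -[X in (_ <= X)%N]card_ord max_card.
have cntA f : cnt f \in A.
  rewrite inE big_tuple -[X in _ == X]card_ord -sum1_card (partition_big f xpredT)//=.
  by apply/eqP/eq_bigr => l _; rewrite cntE -sum1_card; apply: eq_bigl => k; rewrite inE.
have monE (f : {ffun 'I_M -> 'I_d.+1}) i : \prod_k x i ord0 (f k) = mon (cnt f) i.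
  rewrite (partition_big f xpredT)//=; apply: eq_bigr => l _; rewrite cntE -prodr_const.
  by apply: eq_big => k; [rewrite inE | move=> /eqP ->].
have powE i j : dot (x i) (x j) ^+ M = \sum_(f : {ffun 'I_M -> 'I_d.+1}) mon (cnt f) i * mon (cnt f) j.
  rewrite -[X in _ ^+ X]card_ord -prodr_const /dot bigA_distr_bigA.
  by apply: eq_bigr => f _; rewrite big_split !monE.
transitivity (\sum_(f : {ffun 'I_M -> 'I_d.+1}) (\sum_i c i * mon (cnt f) i) ^+ 2); last first.
  by rewrite big1// => f _; rewrite cA// expr0n.
rewrite /qform; under [RHS]eq_bigr do rewrite expr2 big_distrlr.
rewrite [RHS]exchange_big; apply: eq_bigr => i _; rewrite [RHS]exchange_big.
apply: eq_bigr => j _; rewrite powE mulr_sumr; apply: eq_bigr => f _. rewrite /=; ring.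
Qed.

End QuadraticForms.

(** * Positive semidefinite kernels of finite rank *)

Section PsdKernel.
Variables (R : realType) (T : Type) (S : set T) (K : T -> T -> R).
Hypothesis psdK : psd_kernel_on S K.

Lemma psd_qform n (x : 'I_n -> T) c : (forall i, S (x i)) -> 0 <= qform (fun i j => K (x i) (x j)) c.
Proof. by case: psdK => _; apply. Qed.

(** This is Cauchy-Schwarz for a degenerate form: giving [z] the weight [t0] turns the value [0]
    into [t0 ^+ 2 * g + 2 * t0 * s], which takes negative values unless [s = 0]. *)
Lemma psd_null n (x : 'I_n -> T) c : (forall i, S (x i)) ->
  qform (fun i j => K (x i) (x j)) c = 0 -> forall z, S z -> \sum_j c j * K z (x j) = 0.
Proof.
move=> Sx Qc z Sz; have [symK _] := psdK; set s := \sum_j _.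
pose x' (i : 'I_n.+1) := if unlift ord0 i is Some j then x j else z.
have Sx' i : S (x' i) by rewrite /x'; case: unlift.
apply: contrapT => /eqP s0; set g := K z z.
have Q t0 : 0 <= t0 ^+ 2 * g + 2 * t0 * s.
  pose c' (i : 'I_n.+1) := if unlift ord0 i is Some j then c j else t0.
  have := psd_qform c' Sx'; rewrite /qform big_ord_recl big_ord_recl.
  rewrite /c' /x' unlift_none.
  under eq_bigr do rewrite liftK -mulrA.
  rewrite -mulr_sumr -/s.
  have -> : \sum_(i < n) \sum_(j < n.+1)
      (if unlift ord0 (lift ord0 i) is Some j0 then c j0 else t0) *
      (if unlift ord0 j is Some j0 then c j0 else t0) *
      K (if unlift ord0 (lift ord0 i) is Some j0 then x j0 else z)
        (if unlift ord0 j is Some j0 then x j0 else z) = t0 * s.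
    transitivity (\sum_(i < n) (t0 * (c i * K z (x i)) + \sum_(j < n) c i * c j * K (x i) (x j))).
      apply: eq_bigr => i _; rewrite big_ord_recl unlift_none liftK (symK _ z)//; congr (_ + _); first ring.
      by apply: eq_bigr => j _; rewrite liftK.
    by rewrite big_split/= -mulr_sumr -/s [X in _ + X]Qc addr0.
  by rewrite -/g; congr (0 <= _); ring.
have g0 : 0 <= g.
  have := Q 1; have := Q (-1); rewrite !expr2; nra.
(* The denominator [g + 1] keeps the choice valid when [g = 0]. *)
have := Q (- s / (g + 1)).
have -> : (- s / (g + 1)) ^+ 2 * g + 2 * (- s / (g + 1)) * s = - (s ^+ 2 * ((g + 2) / (g + 1) ^+ 2)).
  by field; rewrite gt_eqF// ltr_wpDl.
rewrite oppr_ge0 leNgt mulr_gt0//; first by rewrite exprn_even_gt0.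
by rewrite divr_gt0 ?exprn_gt0// ltr_wpDl.
Qed.

(** A family of points with definite Gram matrix has at most [N] members. For one of maximal size,
    any further point [y] creates a null vector, which by [psd_null] expresses [K z y] through the
    family. *)
Lemma psd_finite_rank N :
  (forall n (x : 'I_n -> T), (N < n)%N -> (forall i, S (x i)) ->
    exists2 c, (exists i, c i != 0) & qform (fun i j => K (x i) (x j)) c = 0) ->
  exists r (x : 'I_r -> T) (cs : T -> 'I_r -> R), (forall i, S (x i)) /\
    forall z y, S z -> S y -> K z y = \sum_i cs y i * K z (x i).
Proof.
move=> dep.
pose A n := `[< exists x : 'I_n -> T, (forall i, S (x i)) /\
  forall c, qform (fun i j => K (x i) (x j)) c = 0 -> forall i, c i = 0 >].
have exA : exists n, A n.
  have x0 : 'I_0 -> T by case.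
  by exists 0%N; apply/asboolP; exists x0; split=> [[]//|c _ []//].
have bndA n : A n -> (n <= N)%N.
  move=> /asboolP[x [Sx indep]]; rewrite leqNgt; apply/negP => Nn.
  have [c [i ci] Qc] := dep _ x Nn Sx.
  by move: ci; rewrite indep ?eqxx.
case: (ex_maxnP exA bndA) => r /asboolP[x [Sx indep]] maxr.
have comb y : S y -> exists cs : 'I_r -> R, forall z, S z -> K z y = \sum_i cs i * K z (x i).
  move=> Sy.
  pose x' (i : 'I_r.+1) := if unlift ord0 i is Some j then x j else y.
  have Sx' i : S (x' i) by rewrite /x'; case: unlift.
  have [c [Qc [i ci]]] : exists c, qform (fun i j => K (x' i) (x' j)) c = 0 /\ exists i, c i != 0.
    apply: contrapT => nex; have : A r.+1.
      apply/asboolP; exists x'; split => // c Qc i; apply: contrapT => /eqP ci.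
      by apply: nex; exists c; split => //; exists i.
    by move=> /maxr; rewrite ltnn.
  have null z (Sz : S z) : c ord0 * K z y + \sum_j c (lift ord0 j) * K z (x j) = 0.
    have := psd_null Sx' Qc Sz; rewrite big_ord_recl /x' unlift_none.
    by under eq_bigr do rewrite liftK.
  (* Otherwise the null vector would live on the independent family alone. *)
  have c0 : c ord0 != 0.
    apply/eqP => c0; move: ci; suff -> : c i = 0 by rewrite eqxx.
    case: (unliftP ord0 i) => [j ->|->//].
    apply: (indep (fun j => c (lift ord0 j))).
    rewrite /qform big1// => l _.
    under eq_bigr do rewrite -mulrA; rewrite -mulr_sumr.
    by have := null _ (Sx l); rewrite c0 mul0r add0r => ->; rewrite mulr0.
  exists (fun j => - c (lift ord0 j) / c ord0) => z Sz.
  apply: (mulfI c0); rewrite mulr_sumr; apply/eqP; rewrite -subr_eq0 -sumrN; apply/eqP.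
  rewrite -[RHS](null z Sz); congr (_ + _); apply: eq_bigr => j _; field; exact: c0.
have /choice[cs csE] : forall y, exists cs : 'I_r -> R, S y -> forall z, S z -> K z y = \sum_i cs i * K z (x i).
  move=> y; have [Sy|nSy] := pselect (S y); last by exists (fun=> 0) => /nSy.
  by have [cs h] := comb y Sy; exists cs.
by exists r, x, cs; split => // z y Sz Sy; exact: csE.
Qed.

End PsdKernel.

(** * Removing a point from a weighted configuration *)

Section SimplexReduction.
Variables (R : realType) (I : finType) (G : I -> I -> R).
Hypotheses (symG : forall i j, G i j = G j i) (psdG : forall c, 0 <= qform G c)
  (G0 : forall i j, 0 <= G i j) (Gdiag : forall i, 0 < G i i).

Lemma null_vector_neg (c : I -> R) : (exists i, c i != 0) ->
  (forall i, \sum_j c j * G i j = 0) -> exists i, c i < 0.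
Proof.
move=> [i ci] Gc; apply: contrapT => nneg.
have c0 j : 0 <= c j by rewrite leNgt; apply/negP => cj; apply: nneg; exists j.
have := Gc i; move=> /eqP; rewrite psumr_eq0; last by move=> j _; exact: mulr_ge0.
by move=> /allP/(_ i (mem_index_enum _))/=; rewrite mulf_eq0 (negbTE ci) gt_eqF.
Qed.

(** The energy is constant along the null vector [c], so the weights can be moved along it until one
    of them vanishes. With the sign of [c] chosen so that the total mass does not decrease,
    rescaling to mass one does not raise the energy. *)
Lemma simplex_reduction (c w : I -> R) : (exists i, c i != 0) ->
  (forall i, \sum_j c j * G i j = 0) -> (forall i, 0 <= w i) -> \sum_i w i = 1 ->
  exists w', [/\ forall i, 0 <= w' i, \sum_i w' i = 1, exists i, w' i = 0 &
    qform G w' <= qform G w].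
Proof.
wlog sc : c / 0 <= \sum_i c i => [W|] cN0 Gc w0 w1.
  have [sc|/ltW sc] := leP 0 (\sum_i c i); first exact: (W c).
  apply: (W (fun i => - c i)) => //; first by rewrite sumrN oppr_ge0.
    by have [i ci] := cN0; exists i; rewrite oppr_eq0.
  by move=> i; under eq_bigr do rewrite mulNr; rewrite sumrN Gc oppr0.
have [i1 ci1] := null_vector_neg cN0 Gc.
(* The negative entry whose weight is exhausted first; [s] is the time at which this happens. *)
case: (@arg_minP _ _ _ i1 (fun i => c i < 0) (fun i => w i / - c i) ci1) => i0 ci0 mini.
set s := w i0 / - c i0 in mini.
have s0 : 0 <= s by rewrite divr_ge0// oppr_ge0 ltW.
pose v i := w i + s * c i.
have v0 i : 0 <= v i.
  rewrite /v; have [ci|ci] := ltP (c i) 0; last by rewrite addr_ge0// mulr_ge0.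
  by have := mini i ci; rewrite ler_pdivlMr ?oppr_gt0// mulrN -subr_ge0 opprK.
have vi0 : v i0 = 0.
  by rewrite /v /s invrN mulrN mulNr divfK ?subrr// lt_eqF.
set sigma := 1 + s * \sum_i c i.
have sig1 : 1 <= sigma by rewrite lerDl mulr_ge0.
have sig0 : 0 < sigma by rewrite (lt_le_trans ltr01).
have sv : \sum_i v i = sigma by rewrite big_split/= w1 -mulr_sumr.
have Qv : qform G v = qform G w.
  have inner (u z : I -> R) i : \sum_j u i * (z j + s * c j) * G i j = \sum_j u i * z j * G i j.
    transitivity (\sum_j u i * z j * G i j + u i * s * \sum_j c j * G i j); last by rewrite Gc mulr0 addr0.
    by rewrite mulr_sumr -big_split; apply: eq_bigr => j _ /=; ring.
  rewrite /qform; under eq_bigr do rewrite /v (inner (fun i => w i + s * c i) w).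
  rewrite exchange_big /=; apply: eq_bigr => j _.
  rewrite -(inner w w j); apply: eq_bigr => i _; rewrite symG; ring.
exists (fun i => v i / sigma); split.
- by move=> i; rewrite divr_ge0// ltW.
- by rewrite -mulr_suml sv mulfV// gt_eqF.
- by exists i0; rewrite vi0 mul0r.
- have -> : qform G (fun i => v i / sigma) = qform G w / sigma ^+ 2.
    rewrite -Qv /qform mulr_suml; apply: eq_bigr => i _; rewrite mulr_suml; apply: eq_bigr => j _.
    by field; rewrite gt_eqF.
  by rewrite ler_pdivrMr ?exprn_gt0// ler_peMr// exprn_ege1.
Qed.

End SimplexReduction.

(** * The kernel and its entrywise powers *)

Section RootKernel.
Variables (R : realType) (d a b : nat).
Hypotheses (d0 : (0 < d)%N) (b0 : (0 < b)%N).
Let p : R := a%:R / b%:R.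

Lemma dotC (x y : 'rV[R]_d) : dot x y = dot y x.
Proof. by apply: eq_bigr => i _; rewrite mulrC. Qed.

Lemma kernel_pC (q : R) (x y : 'rV[R]_d) : kernel_p q x y = kernel_p q y x.
Proof. by rewrite /kernel_p dotC. Qed.

Lemma kernel_p_ge0 (q : R) (x y : 'rV[R]_d) : 0 <= kernel_p q x y.
Proof. exact: powR_ge0. Qed.

Lemma kernel_p_diag (q : R) (x : 'rV[R]_d) : unit_sphere x -> kernel_p q x x = 1.
Proof. by move=> x1; rewrite /kernel_p x1 normr1 powR1. Qed.

Lemma kernel_p_exp (x y : 'rV[R]_d) n : kernel_p p x y ^+ (n * b) = `|dot x y| ^+ (n * a).
Proof.
rewrite /kernel_p -powR_mulrn ?powR_ge0// -powRrM -powR_mulrn//; congr (_ `^ _).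
by rewrite /p !natrM; field; rewrite pnatr_eq0 -lt0n.
Qed.

Lemma kernel_p_double_exp (x y : 'rV[R]_d) : kernel_p p x y ^+ (2 * b) = dot x y ^+ (2 * a).
Proof. by rewrite kernel_p_exp !exprM real_normK ?num_real. Qed.

(** For even [a] the [b]-th power of the kernel is polynomial; for odd [a] the exponents are doubled
    to remove the absolute value. The polynomial kernel is degenerate on so many points, and
    degeneracy descends from an entrywise power to the kernel. *)
Lemma root_kernel_degenerate (S : set 'rV[R]_d) n (x : 'I_n -> 'rV[R]_d) :
  S `<=` @unit_sphere R d -> psd_kernel_on S (@kernel_p R d p) ->
  (bound_R d a < n)%N -> (forall i, S (x i)) ->
  exists2 c, (exists i, c i != 0) & qform (fun i j => kernel_p p (x i) (x j)) c = 0.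
Proof.
move=> Ssph psdK Rn Sx.
have [m [M [m0 powE MR]]] : exists m M, [/\ (0 < m)%N,
    forall x y : 'rV[R]_d, kernel_p p x y ^+ m = dot x y ^+ M & (dim_D d M < n)%N].
  move: Rn; rewrite /bound_R; case: ifPn => oa Rn.
    by exists (2 * b)%N, (2 * a)%N; split => //; [rewrite muln_gt0 | exact: kernel_p_double_exp].
  exists b, a; split => // u v; have := kernel_p_exp u v 1; rewrite !mul1n => ->.
  by rewrite -normrX ger0_norm ?exprn_even_ge0.
have [c c0 Qc] := dot_power_degenerate x d0 MR.
apply: (hadamard_power_degenerate m0 _ _ _ c0).
- by move=> i j; exact: kernel_pC.
- by move=> c'; exact: psd_qform psdK _ _ _ Sx.
- by move=> i; rewrite kernel_p_diag ?oner_eq0//; exact: Ssph.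
- by rewrite -[RHS]Qc; apply: eq_bigr => i _; apply: eq_bigr => j _; rewrite powE.
Qed.

End RootKernel.

(** * Extension of derivations *)

Section DerivationExtension.
Variables (k F : fieldType) (rho : {rmorphism k -> F}) (t : F).
Hypothesis char0 : forall n, n.+1%:R != 0 :> F.

(* A derivation on a subring is encoded by its graph, a subring of the dual
   numbers [F * F] meeting [0 * F] only in [0]. *)
Definition derivation_graph (G : set (F * F)) : Prop :=
  [/\ (forall c, G (rho c, 0)) /\ G (t, 1),
      forall u v, G u -> G v -> G (u.1 + v.1, u.2 + v.2),
      forall u v, G u -> G v -> G (u.1 * v.1, u.1 * v.2 + u.2 * v.1) &
      forall v, G (0, v) -> v = 0].

Section Extend.
Variables (G : set (F * F)) (z : F).
Hypothesis dG : derivation_graph G.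

Let Gr c : G (rho c, 0). Proof. by case: dG => -[]. Qed.
Let GD u v : G u -> G v -> G (u.1 + v.1, u.2 + v.2). Proof. by case: dG => _ + _ _; apply. Qed.
Let GM u v : G u -> G v -> G (u.1 * v.1, u.1 * v.2 + u.2 * v.1). Proof. by case: dG => _ _ + _; apply. Qed.
Let G0 v : G (0, v) -> v = 0. Proof. by case: dG => _ _ _; apply. Qed.

Let GN a b : G (a, b) -> G (- a, - b).
Proof.
move=> Gab; have := GM (Gr (-1)) Gab.
by rewrite /= rmorphN1 mulN1r mul0r addr0 mulN1r.
Qed.

Let G00 : G (0, 0). Proof. by have := Gr 0; rewrite rmorph0. Qed.

Let Gsum I (r : seq I) (P : pred I) (a b : I -> F) :
  (forall i, P i -> G (a i, b i)) -> G (\sum_(i <- r | P i) a i, \sum_(i <- r | P i) b i).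
Proof.
move=> Gab; elim: r => [|i r IH]; first by rewrite !big_nil.
rewrite !big_cons; case: ifPn => // Pi; exact: (GD (Gab _ Pi) IH).
Qed.

(** A polynomial over the dual numbers with coefficients in the graph: [q] collects the derivatives
    of the coefficients of [p]. *)
Definition dual_poly (p q : {poly F}) := forall i, G (p`_i, q`_i).

Lemma dual_polyD p q p' q' : dual_poly p q -> dual_poly p' q' -> dual_poly (p + p') (q + q').
Proof. by move=> h h' i; rewrite !coefD; exact: (GD (h i) (h' i)). Qed.

Lemma dual_polyN p q : dual_poly p q -> dual_poly (- p) (- q).
Proof. by move=> h i; rewrite !coefN; exact: GN. Qed.

Lemma dual_polyM p q p' q' :
  dual_poly p q -> dual_poly p' q' -> dual_poly (p * p') (p * q' + q * p').
Proof.
move=> h h' i; rewrite coefD !coefM -big_split /=.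
by apply: Gsum => j _; exact: (GM (h j) (h' _)).
Qed.

Lemma dual_polyC a b : G (a, b) -> dual_poly a%:P b%:P.
Proof.
by move=> Gab [|i]; rewrite !coefC.
Qed.

Lemma dual_polyXn n : dual_poly 'X^n 0.
Proof.
move=> i; rewrite coefXn coef0; case: (i == n) => //=.
by rewrite -(rmorph1 rho); exact: Gr.
Qed.

Lemma dual_poly_deriv p q : dual_poly p q -> dual_poly p^`() q^`().
Proof.
move=> h i; rewrite !coef_deriv -(mulr_natl p`_i.+1) -(mulr_natl q`_i.+1); have := GM (Gr i.+1%:R) (h i.+1).
by rewrite /= rmorph_nat mul0r addr0.
Qed.

(** The derivative that [p.[z]] must have if [z] has derivative [delta]. *)
Let Lam delta (p q : {poly F}) := q.[z] + p^`().[z] * delta.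

Let LamM delta p q p' q' :
  Lam delta (p * p') (p * q' + q * p') = p.[z] * Lam delta p' q' + Lam delta p q * p'.[z].
Proof. rewrite /Lam derivM !hornerE; ring. Qed.

Let LamB delta p q p' q' :
  Lam delta (p - p') (q - q') = Lam delta p q - Lam delta p' q'.
Proof. rewrite /Lam derivB !hornerE; ring. Qed.

(** If [z] is a root of a nonzero polynomial over the domain of the graph, one of least size has a
    simple root at [z] and dictates [delta]; the others are compared with it by pseudo-division, the
    domain being only a ring. If there is none, [delta] is free and [0] is taken. *)
Lemma extension_slope :
  exists delta, forall p q, dual_poly p q -> p.[z] = 0 -> q.[z] + p^`().[z] * delta = 0.
Proof.
pose A n := exists p q, [/\ dual_poly p q, p != 0, p.[z] = 0 & size p = n].
have [[p0 [q0 [h0 p00 p0z]]]|nA] := pselect (exists p q, [/\ dual_poly p q, p != 0 & p.[z] = 0]); last first.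
  exists 0 => p q h pz; have [p0|pN0] := eqVneq p 0; last by case: nA; exists p, q.
  suff -> : q = 0 by rewrite p0 deriv0 !hornerE.
  apply/polyP => i; rewrite coef0; apply: G0.
  by have := h i; rewrite p0 coef0.
have exA : exists n, `[< A n >] by exists (size p0); apply/asboolP; exists p0, q0.
case: (ex_minnP exA) => n /asboolP[p [q [hpq pN0 pz szp]]] minn.
(* The derivative of [p] is smaller than [p], so it could vanish at [z] only by being zero, which in
   characteristic zero makes [p] constant. *)
have dpN0 : p^`().[z] != 0.
  apply/eqP => dpz; have [dp0|dpN0] := eqVneq p^`() 0; last first.
    have /minn : `[< A (size p^`()) >].
      by apply/asboolP; exists p^`(), q^`(); split => //; exact: dual_poly_deriv.
    by rewrite leqNgt -szp lt_size_deriv.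
  have szp1 : (size p <= 1)%N.
    rewrite leqNgt; apply/negP => sz.
    have := congr1 (fun r : {poly F} => r`_(size p).-2) dp0.
    rewrite coef_deriv coef0 prednK; last by case: (size p) sz => [|[]].
    move/eqP; rewrite -mulr_natl mulf_eq0 -/(lead_coef p) lead_coef_eq0 (negbTE pN0) orbF.
    by have : (0 < (size p).-1)%N by [case: (size p) sz => [|[]]]; case: (size p).-1 => // m _; rewrite (negbTE (char0 m)).
  move: pN0 pz; rewrite (size1_polyC szp1) hornerC polyC_eq0 => + h00; by rewrite h00 eqxx.
exists (- q.[z] / p^`().[z]).
set delta := (X in forall p q, _ -> _ -> q.[z] + _ * X = 0).
have Lp : Lam delta p q = 0 by rewrite /Lam /delta mulrC divfK// addrN.
suff main m : forall p1 q1 : {poly F}, (size p1 <= m)%N -> dual_poly p1 q1 -> p1.[z] = 0 -> Lam delta p1 q1 = 0.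
  by move=> p1 q1; exact: main.
elim: m => [|m IH] p1 q1 sz1 h1 p1z.
  move: sz1; rewrite leqn0 size_poly_eq0 => /eqP p10.
  suff -> : q1 = 0 by rewrite /Lam p10 deriv0 !hornerE.
  apply/polyP => i; rewrite coef0; apply: G0.
  by have := h1 i; rewrite p10 coef0.
have [szm|szm] := leqP (size p1) m; first exact: IH.
have {sz1 szm} szm : size p1 = m.+1 by apply/eqP; rewrite eqn_leq sz1.
have lenp : (size p <= size p1)%N.
  by rewrite szp; apply: minn; apply/asboolP; exists p1, q1; split => //; rewrite -size_poly_eq0 szm.
(* Pseudo-division: [c * p1 - c1 * 'X^e * p] has lost its leading term, and its [Lam] is
   [c * Lam delta p1 q1]. *)
pose c := lead_coef p; pose dc := q`_(size p).-1.
pose c1 := lead_coef p1; pose dc1 := q1`_(size p1).-1.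
pose e := (size p1 - size p)%N.
have hc : dual_poly c%:P dc%:P by apply: dual_polyC; exact: hpq.
have hc1 : dual_poly c1%:P dc1%:P by apply: dual_polyC; exact: h1.
have hA := dual_polyM hc h1.
have hB := dual_polyM hc1 (dual_polyM (dual_polyXn e) hpq).
have hAB := dual_polyD hA (dual_polyN hB).
have LA : Lam delta (c%:P * p1) (c%:P * q1 + dc%:P * p1) = c * Lam delta p1 q1.
  by rewrite LamM p1z mulr0 addr0 hornerC.
have LB : Lam delta (c1%:P * ('X^e * p)) (c1%:P * ('X^e * q + 0 * p) + dc1%:P * ('X^e * p)) = 0.
  by rewrite LamM LamM !hornerM pz Lp !(mulr0, mul0r, addr0).
have : c * Lam delta p1 q1 = 0.
  rewrite -[LHS]subr0 -LA -[X in _ - X]LB -LamB; apply: IH => //; last first.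
    by rewrite hornerD hornerN !hornerM p1z pz !mulr0 subrr.
  have sp : (0 < size p)%N by rewrite size_poly_gt0.
  apply/leq_sizeP => j mj.
  have ej : (e <= j)%N by rewrite /e szm; lia.
  rewrite coefB !coefCM coefXnM ltnNge ej /=.
  have [jm|jm] := leqP j m.
    have -> : j = m by apply/eqP; rewrite eqn_leq jm.
    rewrite /c1 /lead_coef szm /= /e szm /c /lead_coef mulrC.
    have -> : (m - (m.+1 - size p) = (size p).-1)%N by move: lenp; rewrite szm; lia.
    by rewrite subrr.
  rewrite [p1`_ _]nth_default ?szm// [p`_ _]nth_default ?mulr0 ?mulr0 ?subrr//.
  move: lenp jm; rewrite /e szm; move: (size p) => s; clear; lia.
by move/eqP; rewrite mulf_eq0 lead_coef_eq0 (negbTE pN0) => /eqP.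
Qed.

(** The new graph evaluates all dual polynomials at [z]; the choice of the slope [delta] makes it
    single-valued. *)
Lemma derivation_graph_extension :
  exists G' b, [/\ derivation_graph G', G `<=` G' & G' (z, b)].
Proof.
have [delta Hdelta] := extension_slope.
pose ev (p q : {poly F}) := (p.[z], q.[z] + p^`().[z] * delta).
exists [set u | exists p q, dual_poly p q /\ u = ev p q], delta.
have sub u : G u -> exists p q, dual_poly p q /\ u = ev p q.
  case: u => a b Gab; exists a%:P, b%:P; split; first exact: dual_polyC.
  by rewrite /ev derivC !hornerE.
split; first split.
- split=> [c|]; first by apply: sub; exact: Gr.
  by apply: sub; case: dG => -[].
- move=> _ _ [p [q [h ->]]] [p' [q' [h' ->]]]; exists (p + p'), (q + q').
  split; first exact: dual_polyD.
  by rewrite /ev derivD !hornerE /=; congr pair; ring.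
- move=> _ _ [p [q [h ->]]] [p' [q' [h' ->]]].
  exists (p * p'), (p * q' + q * p'); split; first exact: dual_polyM.
  by rewrite /ev derivM !hornerE /=; congr pair; ring.
- by move=> v [p [q [h []]]] /esym pz ->; exact: Hdelta.
- exact: sub.
- exists 'X, 0; split; first by rewrite -['X]expr1; exact: dual_polyXn.
  by rewrite /ev derivX !hornerE.
Qed.
End Extend.

Hypothesis transc : forall p : {poly k}, (map_poly rho p).[t] = 0 -> p = 0.

(** Zorn's lemma starts from differentiation of polynomials in [t], well defined because [t] is
    transcendental. A maximal graph is defined everywhere, since it could be extended to any missing
    element. *)
Lemma derivation_exists : exists D : F -> F,
  [/\ forall x y, D (x + y) = D x + D y,
      forall x y, D (x * y) = D x * y + x * D y,
      forall c, D (rho c) = 0 & D t = 1].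
Proof.
pose P := [set G | G = set0 \/ derivation_graph G].
have dG0 : derivation_graph
    [set ((map_poly rho p).[t], (map_poly rho p)^`().[t]) | p in setT].
  split; first split.
  - by move=> c; exists c%:P => //; rewrite map_polyC derivC !hornerE.
  - by exists 'X => //; rewrite map_polyX derivX !hornerE.
  - move=> _ _ [p _ <-] [q _ <-]; exists (p + q) => //=.
    by rewrite rmorphD derivD !hornerE.
  - move=> _ _ [p _ <-] [q _ <-]; exists (p * q) => //=.
    by rewrite rmorphM derivM !hornerE /=; congr pair; ring.
  - by move=> v [p _ [/transc -> <-]]; rewrite rmorph0 deriv0 horner0.
have [|G [[G_eq0|dG] maxG]] := @Zorn_bigcup _ P.
- move=> C CP totC.
  have [G0|] := pselect (forall X, C X -> X = set0).
    left; apply/seteqP; split => // u [X CX]; by rewrite (G0 _ CX).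
  move/existsNP => [X0 /not_implyP[CX0 X0N0]]; right.
  have dC X u : C X -> X u -> derivation_graph X.
    by move=> CX Xu; have [X0'|//] := CP _ CX; move: Xu; rewrite X0'.
  have dX0 : derivation_graph X0 by have [//|] := CP _ CX0.
  have both u v : (\bigcup_(X in C) X) u -> (\bigcup_(X in C) X) v ->
      exists X, [/\ C X, derivation_graph X, X u & X v].
    move=> [X CX Xu] [Y CY Yv]; have [XY|YX] := totC _ _ CX CY.
      by exists Y; split => //; [exact: dC Yv | exact: XY].
    by exists X; split => //; [exact: dC Xu | exact: YX].
  split.
  + by case: dX0 => -[h1 h2] _ _ _; split=> [c|]; exists X0.
  + by move=> u v /both/[apply] -[X [CX [_ h _ _] Xu Xv]]; exists X => //; exact: h.
  + by move=> u v /both/[apply] -[X [CX [_ _ h _] Xu Xv]]; exists X => //; exact: h.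
  + by move=> v [X CX Xv]; have [_ _ _] := dC _ _ CX Xv; apply.
- case: (maxG _ _ (or_intror dG0)); rewrite G_eq0; split => // /(_ (t, 1)) [].
  by case: dG0 => -[].
have domG z : exists b, G (z, b).
  have [G' [b [dG' GG' G'z]]] := derivation_graph_extension z dG.
  exists b; apply: contrapT => nGz; apply: (maxG G'); last by right.
  by split => // G'G; apply: nGz; exact: G'G.
have [[Gr Gt] GD GM G0] := dG.
have GN a b : G (a, b) -> G (- a, - b).
  move=> Gab; have := GM _ _ (Gr (-1)) Gab.
  by rewrite /= rmorphN1 mulN1r mul0r addr0 mulN1r.
have funG z b c : G (z, b) -> G (z, c) -> b = c.
  move=> Gb /GN Gc; have /= := GD _ _ Gb Gc; rewrite subrr => /G0/eqP.
  by rewrite subr_eq0 => /eqP.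
have /choice [D HD] := domG; exists D; split.
- by move=> x y; apply: funG (HD _) _; exact: (GD _ _ (HD x) (HD y)).
- move=> x y; apply: funG (HD _) _; rewrite addrC; exact: (GM _ _ (HD x) (HD y)).
- by move=> c; exact: funG (HD _) (Gr c).
- exact: funG (HD _) Gt.
Qed.
End DerivationExtension.

(** * Valuation rings *)

Definition subring_set (K : nzRingType) (O : set K) : Prop :=
  [/\ O 1, forall x y, O x -> O y -> O (x - y) & forall x y, O x -> O y -> O (x * y)].

Section SubringSet.
Variables (K : comNzRingType) (O : set K).
Hypothesis sO : subring_set O.

Lemma subring_set1 : O 1. Proof. by case: sO. Qed.
Lemma subring_setB x y : O x -> O y -> O (x - y). Proof. by case: sO => _ + _; apply. Qed.
Lemma subring_setM x y : O x -> O y -> O (x * y). Proof. by case: sO => _ _; apply. Qed.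
Lemma subring_set0 : O 0. Proof. by rewrite -(subrr 1); exact: subring_setB subring_set1 subring_set1. Qed.
Lemma subring_setN x : O x -> O (- x).
Proof. by rewrite -sub0r; exact: subring_setB subring_set0. Qed.
Lemma subring_setD x y : O x -> O y -> O (x + y).
Proof. by move=> Ox Oy; rewrite -[y]opprK; exact: subring_setB (subring_setN _). Qed.
Lemma subring_setX x n : O x -> O (x ^+ n).
Proof. 
move=> Ox; elim: n => [|n IH]; first exact: subring_set1.
by rewrite exprS; exact: subring_setM.
Qed.
Lemma subring_set_sum I (r : seq I) (P : pred I) (f : I -> K) :
  (forall i, P i -> O (f i)) -> O (\sum_(i <- r | P i) f i).
Proof.
move=> Of; apply: (big_ind O) => //; [exact: subring_set0 | exact: subring_setD].
Qed.

Definition poly_over_set (p : {poly K}) := forall i, O p`_i.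

Lemma poly_over_setC c : O c -> poly_over_set c%:P.
Proof. by move=> Oc [|i]; rewrite coefC//=; exact: subring_set0. Qed.
Lemma poly_over_setX : poly_over_set 'X.
Proof. by move=> i; rewrite coefX; case: (_ == _); [exact: subring_set1|exact: subring_set0]. Qed.
Lemma poly_over_setB p q : poly_over_set p -> poly_over_set q -> poly_over_set (p - q).
Proof. by move=> hp hq i; rewrite coefB; exact: subring_setB. Qed.
Lemma poly_over_setM p q : poly_over_set p -> poly_over_set q -> poly_over_set (p * q).
Proof.
by move=> hp hq i; rewrite coefM; apply: subring_set_sum => j _; exact: subring_setM.
Qed.

Lemma subring_set_adjoin z : subring_set [set p.[z] | p in poly_over_set].
Proof.
split.
- by exists 1%:P; rewrite ?hornerC//; exact: poly_over_setC subring_set1.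
- move=> _ _ [p hp <-] [q hq <-]; exists (p - q); rewrite ?hornerE//.
  exact: poly_over_setB.
- move=> _ _ [p hp <-] [q hq <-]; exists (p * q); rewrite ?hornerE//.
  exact: poly_over_setM.
Qed.

End SubringSet.

Lemma subring_set_bigcup (K : comNzRingType) (C : set (set K)) (X0 : set K) :
  C X0 -> total_on C subset -> (forall X, C X -> subring_set X) ->
  subring_set (\bigcup_(X in C) X).
Proof.
move=> CX0 totC dC.
have both u v : (\bigcup_(X in C) X) u -> (\bigcup_(X in C) X) v ->
    exists X, [/\ C X, subring_set X, X u & X v].
  move=> [X CX Xu] [Y CY Yv]; have [XY|YX] := totC _ _ CX CY.
    by exists Y; split => //; [exact: dC | exact: XY].
  by exists X; split => //; [exact: dC | exact: YX].
split.
- by exists X0 => //; exact: subring_set1 (dC _ CX0).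
- by move=> u v /both/[apply] -[X [CX sX Xu Xv]]; exists X => //; exact: subring_setB.
- by move=> u v /both/[apply] -[X [CX sX Xu Xv]]; exists X => //; exact: subring_setM.
Qed.

Section Chevalley.
Variables (K : fieldType) (A : set K) (u : K).
Hypotheses (sA : subring_set A) (Auv : A u^-1) (Au : ~ A u).

(* Chevalley's theorem: a subring maximal among those which contain [A] but not [u]
   is a valuation ring. *)
Lemma valuation_ring_exists : exists O : set K,
  [/\ subring_set O, A `<=` O, ~ O u & forall z, O z \/ O z^-1].
Proof.
pose P := [set O | O = set0 \/ [/\ subring_set O, A `<=` O & ~ O u]].
have [|O [[Oeq0|[sO AO Ou]] maxO]] := @Zorn_bigcup _ P.
- move=> C CP totC.
  have [C0|] := pselect (forall X, C X -> X = set0).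
    left; apply/seteqP; split => // v [X CX]; by rewrite (C0 _ CX).
  move/existsNP => [X0 /not_implyP[CX0 X0N0]]; right.
  have X0ne : X0 !=set0 by apply/set0P/eqP.
  have UE : \bigcup_(X in C) X = \bigcup_(X in C `&` [set X | X !=set0]) X.
    apply/seteqP; split=> z [X CX Xz]; exists X => //.
      by split => //; exists z.
    by case: CX.
  have [//|[_ AX0 _]] := CP _ CX0.
  split; rewrite ?UE.
  + apply: (@subring_set_bigcup _ _ X0).
    * by split.
    * by move=> X Y [CX _] [CY _]; exact: totC.
    * by move=> X [CX [z Xz]]; have [X0'|[]//] := CP _ CX; move: Xz; rewrite X0'.
  + by move=> z Az; exists X0; [split | exact: AX0].
  + by move=> [X [CX [z Xz]] Xu]; have [X0'|[_ _ /(_ Xu)]//] := CP _ CX; move: Xz; rewrite X0'.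
- case: (maxO A); last by right; split.
  rewrite Oeq0; split => // /(_ 1 (subring_set1 sA)) [].
have u0 : u != 0.
  by apply/eqP => u0; apply: Ou; rewrite u0; exact: subring_set0.
have Ot : O u^-1 by exact: AO.
(* By maximality, adjoining any [z] outside [O] brings in [u]. *)
have adj z : ~ O z -> exists2 p, poly_over_set O p & p.[z] = u.
  move=> Oz; apply: contrapT => nex; apply: (maxO [set p.[z] | p in poly_over_set O]).
    split.
      by move=> c Oc; exists c%:P; rewrite ?hornerC//; exact: poly_over_setC.
    move=> sub; apply: Oz; apply: sub; exists 'X; rewrite ?hornerX//; exact: poly_over_setX.
  right; split; first exact: subring_set_adjoin.
    by move=> c /AO Oc; exists c%:P; rewrite ?hornerC//; exact: poly_over_setC.
  by move=> [p hp pz]; apply: nex; exists p.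
(* [u^-1] lies in the Jacobson radical of [O]. If the inverse of [v] were missing, [u] would be a
   polynomial in [v^-1], so [u] times a power of [v] would be in [O]; as powers of [v] are [1]
   modulo [u^-1], so would [u]. *)
have loc e : O e -> O (1 - u^-1 * e)^-1.
  move=> Oe; apply: contrapT => /adj[p hp pv].
  set v := 1 - u^-1 * e in pv *.
  have v0 : v != 0.
    apply/eqP => /eqP; rewrite subr_eq0 => /eqP ue; apply: Ou.
    by rewrite -[u]mulr1 ue mulVKf.
  have Ov : O v by apply: subring_setB => //; [exact: subring_set1|exact: subring_setM].
  have key : O (u * v ^+ size p).
    rewrite -pv horner_coef mulr_suml; apply: subring_set_sum => // i _.
    rewrite -mulrA; apply: subring_setM => //.
    rewrite exprVn mulrC -expfB ?ltn_ord//; exact: subring_setX.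
  have [e' Oe' ve'] : exists2 e', O e' & v ^+ size p = 1 - u^-1 * e'.
    elim: (size p) => [|n [e' Oe' IH]].
      by exists 0; [exact: subring_set0|rewrite mulr0 subr0].
    exists (e + e' - u^-1 * e * e'); last by rewrite exprS IH /v; ring.
    apply: subring_setB => //; first exact: subring_setD.
    by do 2![apply: subring_setM => //].
  apply: Ou; move: key; rewrite ve' mulrBr mulr1 mulVKf// => key.
  by rewrite -[u](subrK e'); exact: subring_setD.
exists O; split => //.
pose deg z n := exists p, [/\ poly_over_set O p, p.[z] = u & (size p <= n.+1)%N].
(* By [loc], the expression of [u] through [z^-1] can be solved for [1] as a combination of positive
   powers of [z^-1]. Multiplied by [z ^+ n.+1], this eliminates the top power from the expression of
   [u] through [z]. *)
have red z n m : z != 0 -> (m <= n.+1)%N -> deg z n.+1 -> deg z^-1 m -> deg z n.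
  move=> z0 mn [p [hp pz szp]] [q [hq qz szq]].
  pose w := (1 - u^-1 * q`_0)^-1.
  have Ow : O w by exact: loc (hq 0).
  have w0 : 1 - u^-1 * q`_0 != 0.
    apply/eqP => /eqP; rewrite subr_eq0 => /eqP ue; apply: Ou.
    by rewrite -[u]mulr1 ue mulVKf.
  pose c i := w * u^-1 * q`_i.+1.
  have Oc i : O (c i) by do 2![apply: subring_setM => //].
  pose r := \sum_(i < m) (c i)%:P * 'X^(n - i).
  have rz : r.[z] = z ^+ n.+1.
    have qE : u = q`_0 + \sum_(i < m) q`_i.+1 * z^-1 ^+ i.+1.
      by rewrite -qz (horner_coef_wide _ szq) big_ord_recl expr0 mulr1.
    have -> : r.[z] = z ^+ n.+1 * (w * u^-1 * \sum_(i < m) q`_i.+1 * z^-1 ^+ i.+1).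
      rewrite /r horner_sum 2!mulr_sumr; apply: eq_bigr => i _.
      rewrite hornerCM hornerXn /c.
      have -> : z ^+ (n - i) = z ^+ n.+1 * z^-1 ^+ i.+1.
        by rewrite exprVn -expfB_cond ?(negbTE z0) ?subSS//= add0n ltnS; have := ltn_ord i; lia.
      by ring.
    have -> : \sum_(i < m) q`_i.+1 * z^-1 ^+ i.+1 = u - q`_0 by rewrite [in RHS]qE; ring.
    rewrite -mulrA mulrBr mulVf// /w mulVf ?mulr1//.
  have hX j : poly_over_set O 'X^j.
    move=> i; rewrite coefXn; case: (_ == _); [exact: subring_set1|exact: subring_set0].
  have hr : poly_over_set O r.
    move=> i; rewrite coef_sum; apply: subring_set_sum => // j _.
    by rewrite coefCM; apply: subring_setM => //; exact: hX.
  have szr : (size r <= n.+1)%N.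
    apply: (leq_trans (size_sum _ _ _)); apply/bigmax_leqP => i _.
    apply: (leq_trans (size_polyMleq _ _)).
    by rewrite size_polyC size_polyXn; case: (c i != 0) => /=; lia.
  exists (\poly_(i < n.+1) p`_i + (p`_n.+1)%:P * r); split.
  - move=> i; rewrite coefD coefCM; apply: subring_setD => //.
      by rewrite coef_poly; case: ifP => _; [exact: hp | exact: subring_set0].
    exact: subring_setM.
  - by rewrite hornerD hornerCM rz horner_poly -pz [in RHS](horner_coef_wide _ szp) [in RHS]big_ord_recr.
  - rewrite (leq_trans (size_polyD _ _))// geq_max size_poly/=.
    by rewrite mul_polyC (leq_trans (size_scale_leq _ _)) ?szr.
have deg0 z : ~ deg z 0.
  move=> [p [hp pz szp]]; apply: Ou; rewrite -pz (size1_polyC szp) hornerC; exact: hp.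
(* Descent on the sum of the two degrees, always shortening the longer expression. *)
have nodeg s : forall z n m, z != 0 -> (n + m <= s)%N -> deg z n -> deg z^-1 m -> False.
  elim: s => [|s IH] z n m z0.
    by rewrite leqn0 addn_eq0 => /andP[/eqP-> _] /deg0.
  wlog mn : z n m z0 / (m <= n)%N => [W|].
    have [mn|/ltnW nm] := leqP m n; first exact: W.
    move=> nms dn dm; apply: (W z^-1 m n) => //; rewrite ?invr_eq0// ?invrK//.
    by rewrite addnC.
  case: n mn => [|n] mn nms dn dm; first exact: (deg0 z).
  by apply: (IH z n m) => //; exact: red dn dm.
move=> z; have [z0|z0] := eqVneq z 0; first by left; rewrite z0; exact: subring_set0.
apply: contrapT => /not_orP[/adj[p hp pz] /adj[q hq qz]].
apply: (nodeg _ z (size p) (size q) z0 (leqnn _)).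
  by exists p; split.
by exists q; split.
Qed.
End Chevalley.

(** * Power series over a valuation ring *)

Section ValuationSeries.
Variables (K : fieldType) (O : set K).
Hypotheses (sO : subring_set O) (valO : forall z, O z \/ O z^-1).

(** This is the maximal ideal of the valuation ring: an element outside [O] has its inverse in [O],
    so it does not qualify. *)
Definition nonunit (z : K) : Prop := z = 0 \/ ~ O z^-1.

Lemma nonunitP z : O z -> ~ nonunit z -> z != 0 /\ O z^-1.
Proof.
move=> Oz nz; split; first by apply/eqP => z0; apply: nz; left.
by apply: contrapT => nOz; apply: nz; right.
Qed.

Lemma nonunit1 : ~ nonunit 1.
Proof.
by case=> [/eqP|]; rewrite ?oner_eq0// invr1 => /(_ (subring_set1 sO)).
Qed.

Lemma nonunitM x y : O x -> nonunit y -> nonunit (x * y).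
Proof.
move=> Ox ny; have [->|x0] := eqVneq x 0; first by left; rewrite mul0r.
case: ny => [->|ny]; first by left; rewrite mulr0.
have [->|y0] := eqVneq y 0; first by left; rewrite mulr0.
right => h; apply: ny; have := subring_setM sO Ox h.
by rewrite invfM mulrA mulrC mulfV// mulr1.
Qed.

Lemma nonunitD x y : nonunit x -> nonunit y -> nonunit (x + y).
Proof.
move=> nx ny; have [x0|x0] := eqVneq x 0; first by rewrite x0 add0r.
have [y0|y0] := eqVneq y 0; first by rewrite y0 addr0.
have Oq := valO (x / y); case: Oq => Oq.
  rewrite (_ : x + y = (x / y + 1) * y); last by rewrite mulrDl divfK// mul1r.
  by apply: nonunitM => //; apply: subring_setD => //; exact: subring_set1.
rewrite (_ : x + y = (1 + (x / y)^-1) * x); last first.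
  by rewrite invfM invrK mulrDl mul1r [_^-1 * y]mulrC divfK.
by apply: nonunitM => //; apply: subring_setD => //; exact: subring_set1.
Qed.

Lemma nonunitN x : nonunit x -> nonunit (- x).
Proof.
move=> nx; rewrite -mulN1r; apply: nonunitM => //.
by apply: subring_setN => //; exact: subring_set1.
Qed.

Lemma nonunit_sum I (r : seq I) (P : pred I) (f : I -> K) :
  (forall i, P i -> nonunit (f i)) -> nonunit (\sum_(i <- r | P i) f i).
Proof. by move=> nf; apply: (big_ind nonunit) => //; [left | exact: nonunitD]. Qed.

Lemma unitX x n : O x -> ~ nonunit x -> ~ nonunit (x ^+ n).
Proof.
move=> Ox /(nonunitP Ox)[x0 Oxv] [/eqP|]; first by rewrite expf_eq0 (negbTE x0) andbF.
by apply; rewrite -exprVn; exact: subring_setX.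
Qed.

(** For [p] over [O]: the reduction of [p] modulo the maximal ideal is divisible by ['X^i]. *)
Definition low_nonunit (p : {poly K}) i := forall j, (j < i)%N -> nonunit p`_j.

(** In the convolution, every term but one has a factor of index below [i] in [p] or below [j] in
    [q]. *)
Lemma lead_unitM p q i j : poly_over_set O p -> poly_over_set O q ->
  low_nonunit p i -> low_nonunit q j ->
  low_nonunit (p * q) (i + j) /\ nonunit ((p * q)`_(i + j) - p`_i * q`_j).
Proof.
move=> Op Oq np nq; split=> [m mij|].
  rewrite coefM; apply: nonunit_sum => -[k km] _ /=.
  have [ki|ik] := ltnP k i; first by rewrite mulrC; apply: nonunitM => //; exact: np.
  by apply: nonunitM => //; apply: nq; lia.
have ij : (i < (i + j).+1)%N by rewrite ltnS leq_addr.
rewrite coefM (bigD1 (Ordinal ij))//= addKn addrC addrK.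
apply: nonunit_sum => -[k km] /=; rewrite -val_eqE/= => ki.
have [{}ki|ik] := ltnP k i; first by rewrite mulrC; apply: nonunitM => //; exact: np.
by apply: nonunitM => //; apply: nq; lia.
Qed.

Lemma lead_unitX p i n : poly_over_set O p -> low_nonunit p i ->
  [/\ poly_over_set O (p ^+ n), low_nonunit (p ^+ n) (n * i) &
      nonunit ((p ^+ n)`_(n * i) - p`_i ^+ n)].
Proof.
move=> Op np; elim: n => [|n [Opn npn lpn]].
  split; first by rewrite expr0; exact: poly_over_setC (subring_set1 sO).
    by move=> j; rewrite mul0n.
  by rewrite mul0n !expr0 coefC /= subrr; left.
have [h1 h2] := lead_unitM Op Opn np npn.
rewrite !exprS mulSn; split => //; first exact: poly_over_setM.
rewrite -(subrK (p`_i * (p ^+ n)`_(n * i)) (_`_(i + _))) -addrA -mulrBr.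
by apply: nonunitD => //; exact: nonunitM.
Qed.

(** Divisibility is total in a valuation ring, so one of finitely many elements divides all the
    others. *)
Lemma maximal_ratio (g : nat -> K) n : g 0%N != 0 ->
  exists i, [/\ (i <= n)%N, g i != 0 & forall j, (j <= n)%N -> O (g j / g i)].
Proof.
move=> g0; elim: n => [|n [i [ien gi Og]]].
  by exists 0%N; split => // -[|//] _; rewrite mulfV//; exact: subring_set1.
have [Oq|nOq] := pselect (O (g n.+1 / g i)).
  exists i; split => //; first exact: leqW.
  by move=> j; rewrite leq_eqVlt => /orP[/eqP->//|]; exact: Og.
have gn0 : g n.+1 != 0.
  by apply/eqP => gn; apply: nOq; rewrite gn mul0r; exact: subring_set0.
have {nOq}Oq : O (g i / g n.+1) by have [//|] := valO (g n.+1 / g i); rewrite invfM invrK mulrC.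
exists n.+1; split => // j; rewrite leq_eqVlt => /orP[/eqP->//|jn].
  by rewrite mulfV//; exact: subring_set1.
have := subring_setM sO (Og j jn) Oq; by rewrite mulrA divfK.
Qed.

Definition spanned (g : nat -> K) n :=
  forall k, exists c : 'I_n -> K, (forall i, O (c i)) /\ g k = \sum_i c i * g i.

(** Dividing by the largest of the first [n] coefficients brings the whole series into [O], the
    others being combinations of these over [O]. That coefficient becomes [1], so the order [k0] of
    the reduction is below [n]. *)
Lemma normalized_series (g : nat -> K) n : g 0%N != 0 -> spanned g n ->
  exists M k0, [/\ M != 0, (k0 < n)%N, forall k, O (g k / M),
    forall k, (k < k0)%N -> nonunit (g k / M) & ~ nonunit (g k0 / M)].
Proof.
case: n => [|n] g0 sg.
  by have [c [_]] := sg 0%N; rewrite big_ord0 => /eqP; rewrite (negbTE g0).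
have [i [ien gi Og]] := maximal_ratio n g0.
have Oall k : O (g k / g i).
  have [c [Oc ->]] := sg k; rewrite mulr_suml; apply: subring_set_sum => // j _.
  rewrite -mulrA; apply: subring_setM => //; apply: Og; by rewrite -ltnS.
have ex : exists k, ~~ `[< nonunit (g k / g i) >].
  by exists i; apply/asboolPn; rewrite mulfV//; exact: nonunit1.
case: (ex_minnP ex) => k0 /asboolPn nk0 mink0.
exists (g i), k0; split => //.
- rewrite (leq_ltn_trans _ (ien : (i < n.+1)%N))//; apply: mink0; apply/asboolPn.
  by rewrite mulfV//; exact: nonunit1.
- move=> k kk0; apply: contrapT => nk; have /mink0 : ~~ `[< nonunit (g k / g i) >] by apply/asboolPn.
  by rewrite leqNgt kk0.
Qed.

(** Stands for the power series with coefficients [g]: coefficient [m] of a power of the series is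
    that of the same power of [truncated g m]. *)
Definition truncated (g : nat -> K) m := \poly_(i < m.+1) g i.

(** Orders of reductions add in products, so the [N]-th power of the normalized series has a
    reduction of order exactly [N * k0]. *)
Lemma truncated_power (g : nat -> K) N k0 M : (0 < N)%N -> M != 0 ->
  (forall k, O (g k / M)) -> (forall k, (k < k0)%N -> nonunit (g k / M)) ->
  ~ nonunit (g k0 / M) ->
  exists G : nat -> K, [/\ forall m, (truncated g m ^+ N)`_m = M ^+ N * G m,
    forall m, O (G m), forall m, (m < N * k0)%N -> nonunit (G m) & ~ nonunit (G (N * k0)%N)].
Proof.
move=> N0 M0 Og ng ug.
pose p m := truncated (fun k => g k / M) m.
have Op m : poly_over_set O (p m).
  by move=> i; rewrite coef_poly; case: ifP => // _; exact: subring_set0.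
have np m : low_nonunit (p m) k0.
  by move=> j jk; rewrite coef_poly; case: ifP => // _; [exact: ng | left].
exists (fun m => (p m ^+ N)`_m); split.
- move=> m; have -> : truncated g m = M *: p m.
    apply/polyP => i; rewrite coefZ !coef_poly; case: ifP => _; last by rewrite mulr0.
    by rewrite mulrC divfK.
  by rewrite exprZn coefZ.
- by move=> m; have [] := lead_unitX N (Op m) (np m).
- by move=> m mk; have [_ + _] := lead_unitX N (Op m) (np m); apply.
- have [_ _ l] := lead_unitX N (Op (N * k0)%N) (np (N * k0)%N) => nG.
  have : nonunit ((p (N * k0)%N)`_k0 ^+ N).
    by rewrite -[X in nonunit X](subKr (p (N * k0)%N ^+ N)`_(N * k0)); apply: nonunitD => //; exact: nonunitN.
  (* Positivity of [N] gives [k0 <= N * k0]: the coefficient [k0] survives the truncation. *)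
  by rewrite coef_poly ltnS leq_pmull//; exact: unitX.
Qed.

(** If [m < n], then [rho = H m / G m] is a nonunit, because [G m] is a unit, and so is every [H i],
    including [H n]. *)
Lemma lead_unit_leq (rho : K) (G H : nat -> K) m n :
  (forall i, rho * G i = H i) -> (forall i, O (G i)) ->
  ~ nonunit (G m) -> (forall i, (i < n)%N -> nonunit (H i)) -> ~ nonunit (H n) ->
  (n <= m)%N.
Proof.
move=> GH OG Gm Hl Hn; rewrite leqNgt; apply/negP => mn.
have [G0 OGv] := nonunitP (OG m) Gm.
have nrho : nonunit rho.
  rewrite -[rho](mulfK G0) GH mulrC; apply: nonunitM => //; exact: Hl.
by apply: Hn; rewrite -GH mulrC; exact: nonunitM.
Qed.

Lemma power_series_root (f h : nat -> K) A B d r :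
  (0 < A)%N -> (0 < B)%N -> h 0%N != 0 -> f 0%N != 0 ->
  (forall m, (truncated f m ^+ B)`_m = (truncated h m ^+ A)`_m) ->
  spanned h d -> spanned f r ->
  (forall j k, (k < d)%N -> B * j = A * k -> k = 0%N)%N ->
  forall k, O (h k / h 0%N).
Proof.
move=> A0 B0 h0 f0 fh sh sf ndiv k.
have [M [k0 [M0 k0d Oh nh uh]]] := normalized_series h0 sh.
have [M' [j0 [M'0 _ Of nf uf]]] := normalized_series f0 sf.
have [H [HE OH nH uH]] := truncated_power A0 M0 Oh nh uh.
have [G [GE OG nG uG]] := truncated_power B0 M'0 Of nf uf.
have MA0 : M ^+ A != 0 by rewrite expf_neq0.
have MB0 : M' ^+ B != 0 by rewrite expf_neq0.
have GH i : M' ^+ B / M ^+ A * G i = H i.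
  by rewrite mulrAC -GE fh HE mulrAC mulfV// mul1r.
have HG i : M ^+ A / M' ^+ B * H i = G i.
  by rewrite mulrAC -HE -fh GE mulrAC mulfV// mul1r.
have le1 := lead_unit_leq GH OG uG nH uH.
have le2 := lead_unit_leq HG OH uH nG uG.
have k00 : k0 = 0%N by apply: (ndiv j0) => //; apply/eqP; rewrite eqn_leq le1 le2.
move: uh; rewrite k00 => /(nonunitP (Oh _))[q0 Oq].
have := subring_setM sO (Oh k) Oq.
by rewrite invfM invrK [_^-1 * M]mulrC mulrA divfK.
Qed.

End ValuationSeries.

Section AlgebraicRatio.
Variables (L K : fieldType) (iota : {rmorphism L -> K}).

Definition lin_spanned (g : nat -> K) n :=
  forall k, exists c : 'I_n -> L, g k = \sum_i iota (c i) * g i.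

(** If [u] is not algebraic over [L], it is not in the ring generated by [L] and [u^-1]. Chevalley's
    theorem then yields a valuation ring over [L] without [u], against [power_series_root]. *)
Lemma power_series_root_algebraic (f h : nat -> K) A B d r :
  (0 < A)%N -> (0 < B)%N -> h 0%N != 0 -> f 0%N != 0 ->
  (forall m, (truncated f m ^+ B)`_m = (truncated h m ^+ A)`_m) ->
  lin_spanned h d -> lin_spanned f r ->
  (forall j k, (k < d)%N -> B * j = A * k -> k = 0%N)%N ->
  forall k, exists p : {poly L}, p != 0 /\ root (map_poly iota p) (h k / h 0%N).
Proof.
move=> A0 B0 h0 f0 fh sh sf ndiv k; set u := h k / h 0%N.
apply: contrapT => nalg.
have img : subring_set (range iota).
  split; first by exists 1; rewrite ?rmorph1.
    by move=> _ _ [x _ <-] [y _ <-]; exists (x - y); rewrite ?rmorphB.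
  by move=> _ _ [x _ <-] [y _ <-]; exists (x * y); rewrite ?rmorphM.
have u0 : u != 0.
  by apply/eqP => u0; apply: nalg; exists 'X; rewrite polyX_eq0 map_polyX rootX u0.
have [|| O [sO AO Ou valO]] := @valuation_ring_exists K _ u (subring_set_adjoin img u^-1).
- exists 'X; rewrite ?hornerX//; exact: poly_over_setX.
- move=> [q hq qu]; apply: nalg.
  have /choice[c cE] : forall i, exists c, iota c = q`_i by move=> i; have [c _] := hq i; exists c.
  pose n := size q; pose S := \sum_(i < n) (c i)%:P * 'X^(n - i) : {poly L}.
  (* The relation [u = q.[u^-1]] multiplied by [u ^+ n]: a monic equation for [u]. *)
  exists ('X^(n.+1) - S); split.
    apply/eqP => /(congr1 (fun r : {poly L} => r`_n.+1)) /eqP.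
    rewrite coefB coefXn eqxx coef0 coef_sum big1 ?subr0 ?oner_eq0// => i _.
    by rewrite coefCM coefXn gtn_eqF ?mulr0// ltnS leq_subr.
  rewrite /root rmorphB /= map_polyXn hornerD hornerN hornerXn rmorph_sum horner_sum /=.
  rewrite (_ : \sum_(i < n) _ = u ^+ n * q.[u^-1]); first by rewrite qu exprSr subrr.
  rewrite horner_coef mulr_sumr; apply: eq_bigr => i _.
  rewrite rmorphM /= map_polyC map_polyXn hornerCM hornerXn /= cE mulrCA; congr (_ * _).
  by rewrite exprVn -expfB_cond ?(negbTE u0) ?add0n// ltnW.
apply: Ou; apply: (power_series_root sO valO A0 B0 h0 f0 fh _ _ ndiv).
  move=> j; have [c ->] := sh j; exists (fun i => iota (c i)); split => // i.
  by apply: AO; exists (iota (c i))%:P; rewrite ?hornerC//; apply: poly_over_setC => //; exists (c i).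
move=> j; have [c ->] := sf j; exists (fun i => iota (c i)); split => // i.
by apply: AO; exists (iota (c i))%:P; rewrite ?hornerC//; apply: poly_over_setC => //; exists (c i).
Qed.
End AlgebraicRatio.

(** * Taylor coefficients of a derivation *)

Section Taylor.
Variables (k F : fieldType) (rho : {rmorphism k -> F}) (D : F -> F).
Hypotheses (char0 : forall n, n.+1%:R != 0 :> F)
  (DD : forall x y, D (x + y) = D x + D y)
  (DM : forall x y, D (x * y) = D x * y + x * D y)
  (Drho : forall c, D (rho c) = 0).

(** The coefficients of [exp(s D) z] as a power series in [s]; by the Leibniz rule this series is
    multiplicative in [z]. *)
Definition taylor (z : F) (i : nat) : F := iter i D z / i`!%:R.

Lemma derivation0 : D 0 = 0.
Proof. by rewrite -{1}(rmorph0 rho) Drho. Qed.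

Lemma derivation_scale c x : D (rho c * x) = rho c * D x.
Proof. by rewrite DM Drho mul0r add0r. Qed.

Lemma derivation_sum I (r : seq I) (P : pred I) (f : I -> F) :
  D (\sum_(i <- r | P i) f i) = \sum_(i <- r | P i) D (f i).
Proof. by apply: (big_morph D) => //; exact: derivation0. Qed.

Lemma iter_derivation0 i : iter i D 0 = 0.
Proof. by elim: i => //= i ->; exact: derivation0. Qed.

Lemma iter_derivation_comb n (w : 'I_n -> k) (X : 'I_n -> F) i :
  iter i D (\sum_j rho (w j) * X j) = \sum_j rho (w j) * iter i D (X j).
Proof.
elim: i => [//|i IH]; rewrite iterS IH derivation_sum.
by apply: eq_bigr => j _; rewrite derivation_scale.
Qed.

Lemma fact_neq0 n : n`!%:R != 0 :> F.
Proof. by case: n`! (fact_gt0 n). Qed.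

Lemma taylor0 z : taylor z 0 = z.
Proof. by rewrite /taylor /= fact0 divr1. Qed.

Lemma taylorS z i : D (taylor z i) = i.+1%:R * taylor z i.+1.
Proof.
rewrite /taylor -(rmorph_nat rho i`!) -fmorphV mulrC derivation_scale fmorphV rmorph_nat.
by rewrite factS natrM invfM mulrCA [i.+1%:R * _]mulrA mulfV ?char0// mul1r mulrC.
Qed.

Lemma taylorM u v m : taylor (u * v) m = \sum_(i < m.+1) taylor u i * taylor v (m - i).
Proof.
elim: m => [|m IH]; first by rewrite big_ord_recl big_ord0 !taylor0 addr0.
apply: (mulfI (char0 m)); rewrite -taylorS IH derivation_sum.
under eq_bigr do rewrite DM !taylorS.
rewrite big_split /= mulr_sumr.
(* The factor [m.+1] is split as [i + (m.+1 - i)] in each term of the Cauchy product. *)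
pose T i := taylor u i * taylor v (m.+1 - i).
transitivity (\sum_(i < m.+2) i%:R * T i + \sum_(i < m.+2) (m.+1 - i)%:R * T i).
  rewrite [X in _ = X + _]big_ord_recl mul0r add0r [X in _ = _ + X]big_ord_recr /= subnn mul0r addr0.
  congr (_ + _); apply: eq_bigr => i _; rewrite /T.
    by rewrite /= /bump /= add1n subSS mulrA.
  have im : (i <= m)%N by rewrite -ltnS.
  by rewrite /= subSn// mulrCA.
rewrite -big_split /=; apply: eq_bigr => i _.
have im : (i <= m.+1)%N by rewrite -ltnS.
by rewrite -mulrDl -natrD subnKC.
Qed.

Lemma taylorX u n m j : (j <= m)%N ->
  (truncated (taylor u) m ^+ n)`_j = taylor (u ^+ n) j.
Proof.
elim: n j => [|n IH] j jm.
  rewrite !expr0 coef1; case: j jm => [|j] _ /=; first by rewrite taylor0.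
  by rewrite /taylor iterSr -(rmorph1 rho) Drho iter_derivation0 mul0r.
rewrite !exprS coefM taylorM; apply: eq_bigr => i _.
have ij : (i <= j)%N by rewrite -ltnS.
by rewrite IH ?(leq_trans (leq_subr _ _))// coef_poly ltnS (leq_trans ij).
Qed.

(** The rows of [i]-th derivatives of the [X l] live in dimension [n], so for some [m <= n] the
    [m]-th is in the span of the earlier ones. That span is then stable under derivation and
    contains all later rows. *)
Lemma derivative_span n (X : 'I_n -> F) i : exists c : 'I_n -> F,
  forall l, iter i D (X l) = \sum_j c j * iter j D (X l).
Proof.
pose v i := \row_l iter i D (X l).
pose M m := \matrix_(j < m, l < n) iter j D (X l).
have rowM m (j : 'I_m) : row j (M m) = v j by apply/rowP => l; rewrite !mxE.
have vM j m : (j < m)%N -> (v j <= M m)%MS.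
  by move=> jm; rewrite -(rowM _ (Ordinal jm)) row_sub.
have [m mn vm] : exists2 m, (m <= n)%N & (v m <= M m)%MS.
  apply: contrapT => nex.
  have rk m : (m <= n.+1)%N -> (m <= \rank (M m))%N.
    elim: m => // m IH mn; have {}IH := IH (ltnW mn).
    have nv : ~~ (v m <= M m)%MS by apply/negP => vm; apply: nex; exists m.
    apply: (leq_ltn_trans IH); apply: rank_ltmx; rewrite ltmxE; apply/andP; split.
      by apply/row_subP => j; rewrite rowM vM// ltnS ltnW.
    by apply: contra nv; apply: submx_trans; exact: vM.
  by have := rk n.+1 (leqnn _); rewrite leqNgt ltnS rank_leq_col.
have all_i j : (v j <= M m)%MS.
  elim: j => [|j /submxP[c cE]].
    by case: m mn vm => // m mn vm; exact: vM.
  have -> : v j.+1 = \row_l D (v j 0 l) by apply/rowP => l; rewrite !mxE.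
  rewrite cE; have -> : \row_l D ((c *m M m) 0 l) =
      \sum_(s < m) (D (c 0 s) *: v s + c 0 s *: v s.+1).
    apply/rowP => l; rewrite !mxE derivation_sum summxE; apply: eq_bigr => s _.
    by rewrite !mxE DM.
  apply: summx_sub => s _; apply: addmx_sub; apply: scalemx_sub; first exact: vM.
  have := ltn_ord s; rewrite leq_eqVlt => /orP[/eqP ->//|sm]; exact: vM.
have /submxP[c cE] : (v i <= M n)%MS.
  apply: submx_trans (all_i i) _; apply/row_subP => j; rewrite rowM vM//.
  exact: leq_trans (ltn_ord j) mn.
exists (fun j => c 0 j) => l; have := congr1 (fun A : 'rV_n => A 0 l) cE.
by rewrite !mxE => ->; apply: eq_bigr => j _; rewrite !mxE.
Qed.

(** As [D] kills the image of [rho], the relations between derivatives of the [X j] pass to all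
    their combinations, with coefficients that do not depend on [w]. *)
Lemma taylor_span n (X : 'I_n -> F) i : exists c : 'I_n -> F,
  forall w : 'I_n -> k, let z := \sum_j rho (w j) * X j in
  taylor z i = \sum_j c j * taylor z j.
Proof.
have [c cE] := derivative_span X i.
exists (fun j => c j * j`!%:R / i`!%:R) => w /=.
set z := \sum_j _.
have -> : taylor z i = (\sum_j c j * iter j D z) / i`!%:R.
  congr (_ / _); rewrite iter_derivation_comb.
  transitivity (\sum_l \sum_j c j * (rho (w l) * iter j D (X l))).
    apply: eq_bigr => l _; rewrite cE mulr_sumr; apply: eq_bigr => j _; ring.
  rewrite exchange_big; apply: eq_bigr => j _.
  by rewrite iter_derivation_comb mulr_sumr.
rewrite mulr_suml; apply: eq_bigr => j _; rewrite /taylor.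
have := fact_neq0 j; have := fact_neq0 i; move=> i0 j0; field; apply/andP; split; by [].
Qed.

End Taylor.

(** * Ultrapowers *)

Section Ultrapower.
Variables (T : pointedType) (k : fieldType) (U : set_system T).
Hypothesis UU : UltraFilter U.

Definition ultra_ideal (_ : UltraFilter U) : (T -> k) -> bool :=
  fun u => `[< U [set z | u z = 0] >].

Lemma ultra_idealP : idealr_closed (ultra_ideal UU : pred (T -> k)).
Proof.
split.
- by apply/asboolP; apply: filterS filterT => z _ /=.
- apply/negP => /asboolP /filter_ex[z] /= /eqP; by rewrite oner_eq0.
- move=> u v w /asboolP Uv /asboolP Uw; apply/asboolP.
  apply: filterS2 Uv Uw => z /= vz wz.
  by rewrite /= !fctE vz wz mulr0 addr0.
Qed.

HB.instance Definition _ := isIdealr.Build (T -> k) (ultra_ideal UU) ultra_idealP.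

Definition ultra_idealr : idealr (T -> k) := Idealr.clone (T -> k) (ultra_ideal UU) _.

Definition ultrapower := {ideal_quot ultra_idealr}.
HB.instance Definition _ := GRing.ComNzRing.on ultrapower.
HB.instance Definition _ := EqQuotient.on ultrapower.

Definition germ : {rmorphism (T -> k) -> ultrapower} := \pi_ultrapower%qT.

Lemma germ_eq0 u : germ u = 0 <-> U [set z | u z = 0].
Proof.
rewrite -(rmorph0 germ); split.
  move/eqP; rewrite -Quotient.idealrBE subr0 => /asboolP //.
by move=> h; apply/eqP; rewrite -Quotient.idealrBE subr0; exact/asboolP.
Qed.

Definition ultra_inv (q : ultrapower) : ultrapower := germ (fun z => (repr q z)^-1).

Lemma ultra_mulVf (q : ultrapower) : q != 0 -> ultra_inv q * q = 1.
Proof.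
rewrite -{1 3}[q]reprK -/(germ _) => q0; rewrite /ultra_inv -rmorphM -(rmorph1 germ).
apply/eqP; rewrite -subr_eq0 -rmorphB; apply/eqP/germ_eq0.
have [Uu|] := in_ultra_setVsetC [set z | repr q z = 0] UU.
  by move/germ_eq0: Uu => /eqP; rewrite (negbTE q0).
apply: filterS => z /= /eqP qz; by rewrite !fctE mulVf// subrr.
Qed.

Lemma ultra_inv0 : ultra_inv 0 = 0.
Proof.
apply/germ_eq0; have /germ_eq0 : germ (repr (0 : ultrapower)) = 0 by exact: reprK.
by apply: filterS => z /= ->; rewrite invr0.
Qed.

HB.instance Definition _ := GRing.ComNzRing_isField.Build ultrapower ultra_mulVf ultra_inv0.

End Ultrapower.

Lemma ultrapower_field (T : pointedType) (k : fieldType) (U : set_system T) :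
  UltraFilter U -> exists (F : fieldType) (g : {rmorphism (T -> k) -> F}),
    (forall u, g u = 0 <-> U [set z | u z = 0]) /\ (forall q, exists u, g u = q).
Proof.
move=> UU; exists (ultrapower k UU), (germ k UU); split; first exact: germ_eq0.
by move=> q; exists (repr q); exact: reprK.
Qed.

Section Germs.
Variables (T : pointedType) (k F : fieldType) (U : set_system T).
Hypothesis UU : UltraFilter U.
Variable g : {rmorphism (T -> k) -> F}.
Hypothesis g0 : forall u, g u = 0 <-> U [set z | u z = 0].

Definition constant_germ (c : k) : F := g (fun=> c).

Lemma constant_germB : zmod_morphism constant_germ.
Proof. by move=> x y; rewrite /constant_germ -rmorphB. Qed.

Lemma constant_germM : monoid_morphism constant_germ.
Proof. by split=> [|x y]; rewrite /constant_germ -1?rmorphM// -(rmorph1 g). Qed.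

HB.instance Definition _ := GRing.isZmodMorphism.Build k F constant_germ constant_germB.
HB.instance Definition _ := GRing.isMonoidMorphism.Build k F constant_germ constant_germM.

Lemma germ_eq u v : U [set z | u z = v z] -> g u = g v.
Proof.
move=> Uuv; apply/eqP; rewrite -subr_eq0 -rmorphB; apply/eqP/g0.
by apply: filterS Uuv => z /= uv; rewrite !fctE uv subrr.
Qed.

Lemma germ_neq0 u : g u != 0 -> U [set z | u z != 0].
Proof.
move=> gu; have [/g0 gu0|] := in_ultra_setVsetC [set z | u z = 0] UU.
  by rewrite gu0 eqxx in gu.
by apply: filterS => z /= /eqP.
Qed.

Lemma germ_sum (I : finType) (u : I -> T -> k) :
  g (fun z => \sum_i u i z) = \sum_i g (u i).
Proof. 
rewrite -rmorph_sum; congr (g _); apply/funext => z.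
by elim/big_rec2: _ => // i x y _ ->.
Qed.

Lemma germ_horner (p : {poly k}) u :
  (map_poly constant_germ p).[g u] = g (fun z => p.[u z]).
Proof.
elim/poly_ind: p => [|p c IH].
  rewrite rmorph0 horner0 -(rmorph0 g); congr (g _); apply/funext => z; by rewrite horner0.
rewrite rmorphD rmorphM /= map_polyX map_polyC !hornerE IH -rmorphM -rmorphD.
by congr (g _); apply/funext => z; rewrite !hornerE !fctE.
Qed.

Lemma germ_div u v : g v != 0 -> g u / g v = g (fun z => u z / v z).
Proof.
move=> gv; apply: (mulIf gv); rewrite divfK// -rmorphM; apply: germ_eq.
by apply: filterS (germ_neq0 gv) => z /= vz; rewrite !fctE divfK.
Qed.

Lemma germ_truncated_power (G : nat -> T -> k) m N j :
  (truncated (fun i => g (G i)) m ^+ N)`_j =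
  g (fun z => (truncated (G ^~ z) m ^+ N)`_j).
Proof.
elim: N j => [|N IH] j.
  rewrite expr0 coef1 -(rmorph_nat g); congr (g _); apply/funext => z.
  rewrite expr0 coef1; by case: (j == 0)%N.
rewrite exprS coefM; under eq_bigr do rewrite IH.
transitivity (\sum_(i < j.+1) g (fun z => (truncated (G ^~ z) m)`_i * (truncated (G ^~ z) m ^+ N)`_(j - i))).
  apply: eq_bigr => i _; rewrite coef_poly; case: ifP => im.
    by rewrite -rmorphM; congr (g _); apply/funext => z; rewrite coef_poly im.
  rewrite mul0r -(rmorph0 g); congr (g _); apply/funext => z.
  by rewrite coef_poly im mul0r.
by rewrite -germ_sum; congr (g _); apply/funext => z; rewrite exprS coefM.
Qed.

Lemma ultra_root (p : {poly k}) u : p != 0 -> U [set z | root p (u z)] ->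
  exists c, U [set z | u z = c].
Proof.
have [n] := ubnP (size p); elim: n p => // n IH p szp p0 Up.
have [z /= /factor_theorem[q pE]] := filter_ex Up.
have [Uc|Uc] := in_ultra_setVsetC [set w | u w = u z] UU; first by exists (u z).
have q0 : q != 0 by apply: contraNneq p0 => q0; rewrite pE q0 mul0r.
apply: (IH q) => //.
  by move: szp; rewrite pE size_Mmonic ?monicXsubC// size_XsubC addn2.
apply: filterS2 Up Uc => w /=; rewrite pE rootM root_XsubC => /orP[//|/eqP->] //.
Qed.

End Germs.

(** * Infinite sets with a positive semidefinite root kernel *)

Section GenericPoint.
Variables (R : realType) (d : nat) (U : set_system 'rV[R]_d).
Hypotheses (UU : UltraFilter U) (nonprincipal : forall z, ~ U [set z]).
Hypothesis Usphere : U (@unit_sphere R d).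
Let T : pointedType := 'rV[R]_d.
Let k : fieldType := R.
Variables (F : fieldType) (g : {rmorphism (T -> k) -> F}).
Hypothesis g0 : forall u, g u = 0 <-> U [set z | u z = 0].
Hypothesis gsurj : forall q, exists u, g u = q.

Let rho : {rmorphism R -> F} := constant_germ g.

(** The coordinates of the generic point, which is the class of the identity map. *)
Definition generic_coord (l : 'I_d) : F := g (fun z => z ord0 l).

Lemma germ_dot y : g (fun z => dot z y) = \sum_l rho (y ord0 l) * generic_coord l.
Proof.
rewrite germ_sum; apply: eq_bigr => l _.
by rewrite /rho /= /constant_germ mulrC -rmorphM; congr (g _); apply/funext.
Qed.

Lemma generic_coord_sqr : \sum_l generic_coord l * generic_coord l = 1.
Proof.
transitivity (g (fun z => dot z z)).
  rewrite germ_sum; apply: eq_bigr => l _.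
  by rewrite -rmorphM; congr (g _); apply/funext.
by rewrite -(rmorph1 g); apply: (germ_eq UU g0); apply: filterS Usphere.
Qed.

Lemma germ_char0 n : n.+1%:R != 0 :> F.
Proof. by rewrite -(rmorph_nat rho) fmorph_eq0 pnatr_eq0. Qed.

(** If all coordinates were algebraic, each would be constant on a large set by [ultra_root], and a
    single point would be large. *)
Lemma transcendental_coord : exists l, forall p : {poly R},
  (map_poly rho p).[generic_coord l] = 0 -> p = 0.
Proof.
apply: contrapT => nex.
have Uc l : exists c, U [set z : 'rV[R]_d | z ord0 l = c].
  have [p pl p0] : exists2 p : {poly R}, (map_poly rho p).[generic_coord l] = 0 & p != 0.
    apply: contrapT => np; apply: nex; exists l => p pl.
    by apply: contrapT => /eqP p0; apply: np; exists p.
  move: pl; rewrite germ_horner => /g0 pl.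
  by apply: (ultra_root UU p0); apply: filterS pl => z /= /eqP.
have /choice[c cU] := Uc.
apply: (@nonprincipal (\row_l c l)).
apply: (@filterS _ U _ _ _ _ (@filter_forall _ _ _ U _ cU)) => z /= zc.
by apply/rowP => l; rewrite mxE.
Qed.

Variable D : F -> F.
Hypotheses (DD : forall x y, D (x + y) = D x + D y)
  (DM : forall x y, D (x * y) = D x * y + x * D y)
  (Drho : forall c, D (rho c) = 0).

(** A maximal independent family in [Y] spans [Y], so the generic point is a combination of its
    constant vectors with coefficients [alpha] in [F]. Its derivative is the combination with
    coefficients [D (alpha i)], and [v] is orthogonal to the family. *)
Lemma large_set_span (Y : set 'rV[R]_d) (v : 'I_d -> F) : U Y ->
  (forall y, Y y -> \sum_l v l * rho (y ord0 l) = 0) ->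
  \sum_l v l * generic_coord l = 0 /\ \sum_l v l * D (generic_coord l) = 0.
Proof.
move=> UY vY.
pose A n := `[< exists M : 'M[R]_(n, d), (forall i, Y (row i M)) /\ row_free M >].
have exA : exists n, A n.
  by exists 0%N; apply/asboolP; exists 0; split=> [[]//|]; rewrite /row_free mxrank0.
have bndA n : A n -> (n <= d)%N.
  by move=> /asboolP[M [_ /eqP <-]]; exact: rank_leq_col.
case: (ex_maxnP exA bndA) => n /asboolP[M [MY freeM]] maxn.
have subM y : Y y -> (y <= M)%MS.
  move=> Yy; apply: contrapT => /negP nyM.
  have : A n.+1.
    apply/asboolP; rewrite -add1n; exists (col_mx y M); split.
      move=> i; rewrite -[i]splitK; case: (fintype.split i) => j /=.
        by rewrite rowKu (_ : row j y = y)//; apply/rowP => l; rewrite mxE ord1.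
      by rewrite rowKd.
    rewrite /row_free eqn_leq rank_leq_row /=.
    have : (\rank M < \rank (col_mx y M))%N.
      apply: rank_ltmx; rewrite ltmxE col_mx_sub (negbTE nyM) andbT.
      by rewrite -addsmxE addsmxSr.
    by rewrite (eqP freeM).
  by move=> /maxn; rewrite ltnn.
pose alpha i := g (fun z => (z *m pinvmx M) ord0 i).
have xE l : generic_coord l = \sum_i rho (M i l) * alpha i.
  under eq_bigr do rewrite mulrC.
  transitivity (\sum_i g (fun z => (z *m pinvmx M) ord0 i * M i l)).
    rewrite -germ_sum; apply: (germ_eq UU g0); apply: filterS UY => z /= /subM zM.
    by rewrite -{1}(mulmxKpV zM) mxE.
  by apply: eq_bigr => i _; rewrite /alpha /rho /= /constant_germ -rmorphM.
have vM i : \sum_l v l * rho (M i l) = 0.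
  by rewrite -[RHS](vY _ (MY i)); apply: eq_bigr => l _; rewrite mxE.
have zero (w : 'I_n -> F) : \sum_l v l * \sum_i rho (M i l) * w i = 0.
  under eq_bigr do rewrite mulr_sumr.
  rewrite exchange_big /= big1// => i _.
  by under eq_bigr do rewrite mulrA; rewrite -mulr_suml vM mul0r.
split; first by under eq_bigr do rewrite xE; exact: zero.
rewrite -[RHS](zero (fun i => D (alpha i))); apply: eq_bigr => l _; congr (_ * _).
by rewrite xE (derivation_sum DD Drho); apply: eq_bigr => i _; rewrite DM Drho mul0r add0r.
Qed.

Lemma germ_sum_sqr0 (v : 'I_d -> F) : \sum_l v l * v l = 0 -> forall l, v l = 0.
Proof.
have /choice[u uE] := fun l => gsurj (v l).
move=> vv l; rewrite -uE; apply/g0.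
have : g (fun z => \sum_l u l z * u l z) = 0.
  by rewrite germ_sum -[RHS]vv; apply: eq_bigr => j _; rewrite -uE -rmorphM.
move/g0; apply: filterS => z /= /eqP; rewrite psumr_eq0; last by move=> j _; rewrite -expr2 sqr_ge0.
by move=> /allP/(_ l (mem_index_enum _))/=; rewrite mulf_eq0 orbb => /eqP.
Qed.

(** For the generic point [x], the vector [v = D x - c x] is orthogonal to a large set, hence to [x]
    and [D x]. Differentiating [x . x = 1] gives [x . D x = 0], so [v . x = 0] yields [c = 0], and
    then [D x . D x = 0]; sums of squares vanish in [F] only trivially. *)
Lemma generic_derivation_eq0 (Y : set 'rV[R]_d) (c : F) : U Y ->
  (forall y, Y y -> D (g (fun z => dot z y)) = c * g (fun z => dot z y)) ->
  forall l, D (generic_coord l) = 0.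
Proof.
move=> UY DY.
pose v l := D (generic_coord l) - c * generic_coord l.
have vY y : Y y -> \sum_l v l * rho (y ord0 l) = 0.
  move=> /DY; rewrite germ_dot (derivation_sum DD Drho) => /eqP.
  rewrite -subr_eq0 => /eqP e; rewrite -[RHS]e mulr_sumr -sumrB; apply: eq_bigr => l _.
  by rewrite (derivation_scale DM Drho) /v; ring.
have [vx vDx] := large_set_span UY vY.
have xDx : \sum_l generic_coord l * D (generic_coord l) = 0.
  have : D 1 = 0 by rewrite -(rmorph1 rho) Drho.
  rewrite -generic_coord_sqr (derivation_sum DD Drho).
  under eq_bigr do rewrite DM mulrC -mulr2n.
  rewrite sumrMnl -mulr_natl => /eqP; rewrite mulf_eq0 (negbTE (germ_char0 1)).
  by move=> /eqP.
have c0 : c = 0.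
  have : \sum_l v l * generic_coord l =
      \sum_l generic_coord l * D (generic_coord l) - c * \sum_l generic_coord l * generic_coord l.
    by rewrite mulr_sumr -sumrB; apply: eq_bigr => l _; rewrite /v; ring.
  by rewrite vx xDx generic_coord_sqr mulr1 sub0r => /esym/eqP; rewrite oppr_eq0 => /eqP.
apply: germ_sum_sqr0; rewrite -[RHS]vDx; apply: eq_bigr => l _.
by rewrite /v c0 mul0r subr0.
Qed.

End GenericPoint.

Theorem ultrafilter_root_kernel (R : realType) (d a b r : nat) (U : set_system 'rV[R]_d)
    (K : 'rV[R]_d -> 'rV[R]_d -> R) (S : set 'rV[R]_d) (xs : 'I_r -> 'rV[R]_d)
    (cs : 'rV[R]_d -> 'I_r -> R) :
  UltraFilter U -> (forall z, ~ U [set z]) -> U S -> S `<=` @unit_sphere R d ->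
  (forall z y, S z -> S y -> K z y = \sum_i cs y i * K z (xs i)) ->
  (forall z y, K z y ^+ (2 * b) = dot z y ^+ (2 * a)) ->
  (0 < a)%N -> (0 < b)%N -> coprime a b -> (b < d)%N.
Proof.
move=> UU nonprincipal US Ssph finrank rootK a0 b0 ab; rewrite ltnNge; apply/negP => db.
have Usphere : U (@unit_sphere R d) by exact: filterS Ssph US.
have [F [g [g0 gsurj]]] := ultrapower_field R UU.
pose rho : {rmorphism R -> F} := constant_germ g.
have char0 := germ_char0 g.
have [l0 transc] := transcendental_coord UU nonprincipal g0.
have [D [DD DM Drho Dl0]] := derivation_exists char0 transc.
pose h (y : 'rV[R]_d) : F := \sum_l rho (y ord0 l) * generic_coord g l.
(* Defined by the finite-rank expansion, so that [taylor_span] applies to every [y]; for [y] in [S]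
   it is the germ of [K ^~ y]. *)
pose f (y : 'rV[R]_d) : F := \sum_i rho (cs y i) * g (K ^~ (xs i)).
have fh y : S y -> f y ^+ (2 * b) = h y ^+ (2 * a).
  move=> Sy; have -> : f y = g (K ^~ y).
    transitivity (\sum_i g (fun z => cs y i * K z (xs i))).
      by apply: eq_bigr => i _; rewrite /rho /= /constant_germ -rmorphM.
    rewrite -germ_sum; apply: (germ_eq UU g0); apply: filterS US => z Sz /=.
    by rewrite finrank.
  rewrite -[h y]germ_dot -!rmorphXn; congr (g _); apply/funext => z.
  have expE (u : 'rV[R]_d -> R) n : (u ^+ n) z = u z ^+ n.
    by rewrite fctE.
  by rewrite !expE.
(* A second ultrapower, with [F] as constants, makes [y] generic as well. *)
have [Phi [g2 [g20 _]]] := ultrapower_field F UU.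
pose iota : {rmorphism F -> Phi} := constant_germ g2.
pose H k := g2 (fun y => taylor D (h y) k).
pose Fs k := g2 (fun y => taylor D (f y) k).
have spanH n (w : 'rV[R]_d -> 'I_n -> R) X :
    lin_spanned iota (fun k => g2 (fun y => taylor D (\sum_j rho (w y j) * X j) k)) n.
  move=> k; have [c cE] := taylor_span char0 DD DM Drho X k.
  exists c; transitivity (\sum_i g2 (fun y => c i * taylor D (\sum_j rho (w y j) * X j) i)).
    by rewrite -germ_sum; congr (g2 _); apply/funext => y; exact: cE.
  by apply: eq_bigr => i _; rewrite /iota /= /constant_germ -rmorphM.
(* Otherwise the generic point would be orthogonal to itself, although its square is [1]. *)
have hU : U [set y | h y != 0].
  have [h0|] := in_ultra_setVsetC [set y | h y = 0] UU; last by apply: filterS => y /= /eqP.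
  have [|+ _] := large_set_span UU g0 DD DM Drho (v := generic_coord g) h0.
    by move=> y h0y; rewrite -[RHS]h0y; apply: eq_bigr => l _; rewrite mulrC.
  by rewrite (generic_coord_sqr UU Usphere g0) => /eqP; rewrite oner_eq0.
have tay0 z : taylor D z 0 = z := taylor0 D z.
have H0 : H 0%N != 0.
  apply/eqP => /g20 H0; have [y [/= +]] := filter_ex (filterI H0 hU).
  by rewrite tay0 => -> /eqP.
have F0 : Fs 0%N != 0.
  apply/eqP => /g20 F0; have [y [/= +]] := filter_ex (filterI (filterI F0 US) hU).
  rewrite tay0 => -[f0 Sy]; have := fh _ Sy; rewrite f0 expr0n muln_eq0 [b == _]eqn0Ngt b0 /=.
  by move/esym/eqP; rewrite expf_eq0 => /andP[_ ->].
have ident m : (truncated Fs m ^+ (2 * b))`_m = (truncated H m ^+ (2 * a))`_m.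
  rewrite !germ_truncated_power; apply: (germ_eq UU g20); apply: filterS US => y Sy /=.
  by rewrite !(taylorX char0 DD DM Drho)// fh.
(* By coprimality [b] divides [k], while [k < d <= b]. *)
have ndiv j k : (k < d)%N -> (2 * b * j = 2 * a * k)%N -> k = 0%N.
  move=> kd /eqP; rewrite -!mulnA eqn_pmul2l// => /eqP bj.
  have : (b %| k)%N by rewrite -(@Gauss_dvdr _ a) 1?coprime_sym// -bj dvdn_mulr.
  by case: k kd {bj} => // k kd /dvdn_leq => /(_ isT) bk; move: (leq_trans kd db); rewrite ltnNge bk.
(* The coefficient of index [1] gives the logarithmic derivative [D (h y) / h y]; being algebraic
   over [F], it has the same value [c] for almost all [y]. *)
have [p [p0]] := power_series_root_algebraic (ltac:(by rewrite muln_gt0) : (0 < 2 * a)%N)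
  (ltac:(by rewrite muln_gt0) : (0 < 2 * b)%N) H0 F0 ident (spanH _ _ _) (spanH _ _ _) ndiv 1%N.
rewrite (germ_div UU g20)// /root germ_horner => /eqP/g20 proot.
have [|c cU] := ultra_root UU p0 (u := fun y => taylor D (h y) 1 / taylor D (h y) 0).
  by apply: filterS proot => y /= /eqP.
have := generic_derivation_eq0 UU Usphere g0 gsurj DD DM Drho (c := c) (filterI cU hU) _ l0.
rewrite Dl0 => H1; move: (oner_neq0 F); rewrite H1 ?eqxx// => y [/= + hy].
rewrite germ_dot -/rho -/(h y) tay0 (_ : taylor D (h y) 1 = D (h y)) => [<-|]; last by rewrite /taylor divr1.
by rewrite divfK.
Qed.

Lemma free_ultrafilter (T : Type) (S : set T) : infinite_set S ->
  exists U : set_system T, [/\ UltraFilter U, U S & forall z, ~ U [set z]].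
Proof.
move=> infS; pose C : set_system T := [set A | finite_set (S `\` A)].
have FC : ProperFilter C.
  split; first by rewrite /C /= setD0.
  split.
  - by rewrite /C /= setDT.
  - by move=> A B; rewrite /C /= setDIr finite_setU.
  - by move=> A B AB; apply: sub_finite_set => z [Sz nBz]; split => // /AB.
have [U [UU CU]] := ultraFilterLemma FC; exists U; split => //.
  by apply: CU; rewrite /C /= setDv.
move=> z Uz.
have UCz : U (~` [set z]).
  by apply: CU; rewrite /C /= setDE setCK; apply: sub_finite_set (finite_set1 z) => w [].
by have [w []] := filter_ex (filterI Uz UCz).
Qed.

Theorem infinite_psd_root_kernel (R : realType) (d a b : nat) (S : set 'rV[R]_d) :
  (0 < d)%N -> (0 < a)%N -> (0 < b)%N -> coprime a b ->
  S `<=` @unit_sphere R d -> infinite_set S ->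
  psd_kernel_on S (@kernel_p R d (a%:R / b%:R)) -> (b < d)%N.
Proof.
move=> d0 a0 b0 ab Ssph infS psdK.
have [U [UU US nonprincipal]] := free_ultrafilter infS.
have [|r [x [cs [_ finrank]]]] := psd_finite_rank psdK (N := bound_R d a).
  by move=> n x Rn Sx; exact: root_kernel_degenerate Ssph psdK Rn Sx.
apply: (ultrafilter_root_kernel UU nonprincipal US Ssph finrank _ a0 b0 ab).
by move=> z y; exact: (kernel_p_double_exp _ b0).
Qed.

(** * Topology of the sphere *)

Section SphereTopology.
Variables (R : realType) (d : nat).
Local Notation V := 'rV[R]_d.
Local Notation D := (@unit_sphere R d).

(** Away from [0] the power is differentiable; at [0] the bound [e] is met as soon as the argument
    is below [e] to the power [q^-1]. *)
Lemma powR_norm_continuous (q : R) : 0 < q -> continuous (fun t : R => `|t| `^ q).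
Proof.
move=> q0 t; have [->|t0] := eqVneq t 0.
  apply/(@cvgrPdist_lt _ R^o) => e e0; rewrite normr0 powR0 ?gt_eqF//.
  near=> s; rewrite sub0r normrN ger0_norm ?powR_ge0//.
  have -> : e = (e `^ q^-1) `^ q by rewrite -powRrM mulVf ?gt_eqF// powRr1// ltW.
  apply: gt0_ltr_powR => //; rewrite ?nnegrE ?powR_ge0//.
  by near: s; apply: (@nbhs0_lt _ R^o); rewrite powR_gt0.
apply: (@continuous_comp _ _ _ (fun t : R => `|t|) (fun s => s `^ q)).
  exact: norm_continuous.
apply: differentiable_continuous; apply/derivable1_diffP.
by apply: derivable_powR; rewrite in_itv/= andbT normr_gt0.
Unshelve. all: by end_near. Qed.

Lemma sum_continuous (T : topologicalType) (I : Type) (r : seq I) (P : pred I) (F : I -> T -> R) :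
  (forall i, P i -> continuous (F i)) -> continuous (fun x => \sum_(i <- r | P i) F i x).
Proof. by apply: continuous_big => z; apply: (@cvgD _ R^o); [exact: cvg_fst | exact: cvg_snd]. Qed.

Lemma dot_continuous : continuous (fun z : V * V => dot z.1 z.2).
Proof.
apply: sum_continuous => i _ z; apply: (@cvgM R).
  by apply: (@cvg_comp _ _ _ fst (fun v : V => v ord0 i)); [exact: cvg_fst|exact: coord_continuous].
by apply: (@cvg_comp _ _ _ snd (fun v : V => v ord0 i)); [exact: cvg_snd|exact: coord_continuous].
Qed.

Lemma kernel_continuous (q : R) : 0 < q -> continuous (fun z : V * V => kernel_p q z.1 z.2).
Proof.
move=> q0 z; apply: (@continuous_comp _ _ _ (fun z : V * V => dot z.1 z.2) (fun t => `|t| `^ q)).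
  exact: dot_continuous.
exact: powR_norm_continuous.
Qed.

Lemma kernel_continuous1 (q : R) y : 0 < q -> continuous (fun x : V => kernel_p q x y).
Proof.
move=> q0 x; apply: (@continuous_comp _ _ _ (fun x : V => (x, y)) (fun z : V * V => kernel_p q z.1 z.2)).
  apply: (@cvg_pair _ _ _ (nbhs x) (nbhs x) (nbhs y)); [exact: cvg_id | exact: cvg_cst].
exact: (kernel_continuous q0).
Qed.

Lemma sphere_closed : closed D.
Proof.
rewrite (_ : D = (fun x : V => dot x x) @^-1` [set 1])//.
apply: closed_comp; last exact: closed_eq.
move=> x _; apply: (@continuous_comp _ _ _ (fun x : V => (x, x)) (fun z : V * V => dot z.1 z.2)).
  apply: (@cvg_pair _ _ _ (nbhs x) (nbhs x) (nbhs x)); exact: cvg_id.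
exact: dot_continuous.
Qed.

Lemma sphere_compact : compact D.
Proof.
have cI : compact [set v : V | forall i, v ord0 i \in `[(-1 : R), 1]].
  apply: (@rV_compact _ _ (fun=> `[(-1 : R), 1]%classic)) => _.
  exact: segment_compact.
apply: subclosed_compact sphere_closed cI _ => x Dx i.
rewrite in_itv/= -ler_norml -(@ler_pXn2r _ 2)// ?nnegrE// expr1n real_normK ?num_real//.
rewrite -Dx /dot (bigD1 i)//= -expr2 lerDl sumr_ge0// => j _; exact: sqr_ge0.
Qed.

(** Joint continuity gives a neighbourhood of [y] for each [x]; compactness of the sphere makes it
    uniform in [x]. *)
Lemma kernel_sphere_equicontinuous (q : R) (y : V) (e : R) : 0 < q -> 0 < e ->
  \forall y' \near y, forall x, D x -> `|kernel_p q x y - kernel_p q x y'| < e.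
Proof.
move=> q0 e0; have /compact_near_coveringP cov := sphere_compact.
apply: (cov _ (nbhs y) (fun y' x => `|kernel_p q x y - kernel_p q x y'| < e)) => x Dx.
have e20 : 0 < e / 2 by rewrite divr_gt0.
have c1 : \forall z \near (x, y), `|kernel_p q x y - kernel_p q z.1 z.2| < e / 2.
  have kc : continuous (fun z : V * V => kernel_p q z.1 z.2) by exact: kernel_continuous.
  exact: (@cvgr_dist_lt _ R^o _ _ _ _ _ (kc (x, y)) _ e20).
have c2 : \forall x' \near x, `|kernel_p q x y - kernel_p q x' y| < e / 2.
  have kc : continuous (fun x : V => kernel_p q x y) by exact: kernel_continuous1.
  exact: (@cvgr_dist_lt _ R^o _ _ _ _ _ (kc x) _ e20).
have c2' : \forall z \near (x, y), `|kernel_p q x y - kernel_p q z.1 y| < e / 2.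
  exact: (@cvg_fst _ _ (nbhs x) (nbhs y) _ _ c2).
suff : \forall z \near (x, y), `|kernel_p q z.1 y - kernel_p q z.1 z.2| < e by [].
apply: filterS2 c1 c2' => z /= h1 h2.
rewrite (le_lt_trans (ler_distD (kernel_p q x y) _ _))//.
by rewrite [e]splitr ltrD// distrC.
Qed.

End SphereTopology.

(** * Integration on the sphere *)

Section Density.
Context {disp : measure_display} {T : measurableType disp} {R : realType}.
Variables (mu : probability T R) (w : T -> R).
Hypotheses (mw : measurable_fun setT w) (w0 : forall x, 0 <= w x)
  (w1 : (\int[mu]_x (w x)%:E = 1)%E).

Definition density_measure (_ : (\int[mu]_x (w x)%:E = 1)%E) (_ : measurable_fun setT w)
  (_ : forall x, 0 <= w x) (A : set T) : \bar R := (\int[mu]_(x in A) (w x)%:E)%E.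

Local Notation nu := (density_measure w1 mw w0).

Let nu0 : nu set0 = 0%E. Proof. by rewrite /density_measure integral_set0. Qed.
Let nu_ge0 A : (0 <= nu A)%E.
Proof. by apply: integral_ge0 => x _; rewrite lee_fin. Qed.
Let nu_additive : semi_sigma_additive nu.
Proof.
apply: (@semi_sigma_additive_nng_induced _ _ _ mu (fun x => (w x)%:E)).
  exact/measurable_EFinP.
by move=> x; rewrite lee_fin.
Qed.

HB.instance Definition _ := isMeasure.Build _ _ _ nu nu0 nu_ge0 nu_additive.
HB.instance Definition _ := Measure_isProbability.Build _ _ _ nu w1.

(** The density agrees almost everywhere with the Radon-Nikodym derivative, whose change of
    variables formula therefore applies to [w]. *)
Lemma density_probability : exists rho : probability T R,
  (forall A, rho A = (\int[mu]_(x in A) (w x)%:E)%E) /\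
  forall (f : T -> \bar R) E, measurable E -> (forall x, (0 <= f x)%E) -> measurable_fun E f ->
    (\int[rho]_(x in E) f x = \int[mu]_(x in E) (f x * (w x)%:E))%E.
Proof.
pose rho : probability T R := nu.
exists rho; split => // f E mE f0 mf.
have dom : rho `<< mu.
  apply/null_content_dominatesP => A mA muA; rewrite /rho /= /density_measure.
  apply: null_set_integral => //; apply: measurable_funTS; exact/measurable_EFinP.
rewrite -(Radon_Nikodym_SigmaFinite.change_of_variables dom f0 mE mf).
have int_w : mu.-integrable setT (fun x => (w x)%:E).
  apply/integrableP; split; first exact/measurable_EFinP.
  by under eq_integral do rewrite gee0_abs ?lee_fin//; rewrite w1 ltry.
apply: ae_eq_integral => //.
- apply: emeasurable_funM => //; apply: measurable_funTS.
  exact: measurable_int (Radon_Nikodym_SigmaFinite.f_integrable _).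
- apply: emeasurable_funM => //; apply: measurable_funTS; exact/measurable_EFinP.
- apply: ae_eqe_mul2l; apply: integral_ae_eq => //.
  + exact: integrableS (Radon_Nikodym_SigmaFinite.f_integrable dom).
  + by apply: measurable_funTS; exact/measurable_EFinP.
  + by move=> A AE mA; rewrite -Radon_Nikodym_SigmaFinite.f_integral.
Qed.

End Density.

Section BorelSphere.
Variables (R : realType) (d : nat).
Local Notation V := 'rV[R]_d.
Local Notation D := (@unit_sphere R d).

Lemma open_borel (A : set V) : open A -> measurable (A : set (borelRn R d)).
Proof. by move=> oA; exact: sub_sigma_algebra. Qed.

Lemma sphere_borel : measurable (D : set (borelRn R d)).
Proof. 
rewrite -(setCK D); apply: measurableC; apply: open_borel.
by rewrite openC; exact: sphere_closed.
Qed.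

Lemma continuous_borel (f : V -> R) : continuous f ->
  measurable_fun [set: borelRn R d] (f : borelRn R d -> R).
Proof.
move=> cf; apply: (measurability _ (RGenOpens.measurableE R)) => //.
move=> _ [_ [x [y ->]] <-]; rewrite setTI; apply: open_borel.
by apply: open_comp; [move=> z _; exact: cf | exact: interval_open].
Qed.

Variable mu : probability (borelRn R d) R.
Hypothesis muD : mu D = 1%E.

(** A bound is asked only on the sphere, so that every continuous function qualifies. *)
Definition bounded_borel (g : V -> R) : Prop :=
  measurable_fun [set: borelRn R d] (g : borelRn R d -> R) /\
  exists M, forall x, D x -> `|g x| <= M.

Lemma bounded_borel_integrable g : bounded_borel g ->
  mu.-integrable (D : set (borelRn R d)) (EFin \o g).
Proof.
move=> [mg [M gM]]; apply: measurable_bounded_integrable.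
- exact: sphere_borel.
- exact: le_lt_trans (probability_le1 mu sphere_borel) (ltry _).
- exact: measurable_funTS.
- exists M; split; first exact: num_real.
  by move=> N MN x Dx; exact: le_trans (gM x Dx) (ltW MN).
Qed.

Lemma bounded_borel_cst c : bounded_borel (fun=> c).
Proof. by split; [exact: measurable_cst | exists `|c|]. Qed.

Lemma bounded_borelD f g : bounded_borel f -> bounded_borel g -> bounded_borel (fun x => f x + g x).
Proof.
move=> [mf [M fM]] [mg [N gN]]; split; first exact: measurable_funD.
by exists (M + N) => x Dx; apply: (le_trans (ler_normD _ _)); apply: lerD; [exact: fM|exact: gN].
Qed.

Lemma bounded_borelM f g : bounded_borel f -> bounded_borel g -> bounded_borel (fun x => f x * g x).
Proof.
move=> [mf [M fM]] [mg [N gN]]; split; first exact: measurable_funM.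
by exists (M * N) => x Dx; rewrite normrM ler_pM//; [exact: fM|exact: gN].
Qed.

Lemma bounded_borelZ c g : bounded_borel g -> bounded_borel (fun x => c * g x).
Proof. exact: bounded_borelM (bounded_borel_cst c). Qed.

Lemma bounded_borel_sum I (r : seq I) (g : I -> V -> R) :
  (forall i, bounded_borel (g i)) -> bounded_borel (fun x => \sum_(i <- r) g i x).
Proof.
move=> bg; elim: r => [|i r IH].
  rewrite (_ : (fun _ => _) = fun=> 0); first exact: bounded_borel_cst.
  by apply/funext => x; rewrite big_nil.
rewrite (_ : (fun _ => _) = fun x => g i x + \sum_(i <- r) g i x); last first.
  by apply/funext => x; rewrite big_cons.
exact: bounded_borelD.
Qed.

Lemma bounded_borel_continuous g : continuous g -> bounded_borel g.
Proof.
move=> cg; split; first exact: continuous_borel.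
have : compact ((fun x => `|g x|) @` D).
  apply: continuous_compact; last exact: sphere_compact.
  by apply: continuous_subspaceT => x; apply: continuous_comp (cg x) _; exact: norm_continuous.
move=> /compact_bounded[M [_ HM]]; exists (M + 1) => x Dx.
rewrite -[leLHS]normr_id; apply: HM; first by rewrite ltrDl.
by exists x.
Qed.

Lemma bounded_borel_indic (A : set V) : measurable (A : set (borelRn R d)) ->
  bounded_borel (\1_A : V -> R).
Proof.
move=> mA; split; first exact: measurable_indic.
by exists 1 => x _; rewrite indicE; case: (_ \in _); rewrite ?normr1 ?normr0.
Qed.

Definition mean (g : V -> R) : R := \int[mu]_(x in (D : set (borelRn R d))) g x.

Lemma meanE g : bounded_borel g ->
  (\int[mu]_(x in (D : set (borelRn R d))) (g x)%:E)%E = (mean g)%:E.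
Proof.
move=> bg; rewrite fineK//; apply: integrable_fin_num; first exact: sphere_borel.
exact: bounded_borel_integrable.
Qed.

Lemma eq_mean f g : (forall x, D x -> f x = g x) -> mean f = mean g.
Proof. by move=> fg; apply: eq_Rintegral => x /set_mem Dx; exact: fg. Qed.

Lemma mean_cst c : mean (fun=> c) = c.
Proof. by rewrite /mean (Rintegral_cst mu sphere_borel) [X in fine X]muD mulr1. Qed.

Lemma meanD f g : bounded_borel f -> bounded_borel g -> mean (fun x => f x + g x) = mean f + mean g.
Proof.
by move=> bf bg; apply: RintegralD; [exact: sphere_borel | exact: bounded_borel_integrable..].
Qed.

Lemma meanZ c g : bounded_borel g -> mean (fun x => c * g x) = c * mean g.
Proof.
by move=> bg; apply: RintegralZl; [exact: sphere_borel | exact: bounded_borel_integrable].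
Qed.

Lemma bounded_borelB f g : bounded_borel f -> bounded_borel g -> bounded_borel (fun x => f x - g x).
Proof.
move=> bf bg; rewrite (_ : (fun x => _) = fun x => f x + -1 * g x).
  by apply: bounded_borelD => //; exact: bounded_borelZ.
by apply/funext => x; rewrite mulN1r.
Qed.

Lemma meanB f g : bounded_borel f -> bounded_borel g -> mean (fun x => f x - g x) = mean f - mean g.
Proof.
by move=> bf bg; apply: RintegralB; [exact: sphere_borel | exact: bounded_borel_integrable..].
Qed.

Lemma mean_sum I (r : seq I) (g : I -> V -> R) :
  (forall i, bounded_borel (g i)) -> mean (fun x => \sum_(i <- r) g i x) = \sum_(i <- r) mean (g i).
Proof.
move=> bg; elim: r => [|i r IH].
  rewrite big_nil -[RHS](mean_cst 0); apply: eq_mean => x _; by rewrite big_nil.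
rewrite big_cons -IH -meanD//; last exact: bounded_borel_sum.
by apply: eq_mean => x _; rewrite big_cons.
Qed.

Lemma le_mean f g : bounded_borel f -> bounded_borel g ->
  (forall x, D x -> f x <= g x) -> mean f <= mean g.
Proof.
by move=> bf bg fg; apply: le_Rintegral => //; [exact: sphere_borel | exact: bounded_borel_integrable..].
Qed.

Lemma norm_mean_le g M : bounded_borel g -> (forall x, D x -> `|g x| <= M) -> `|mean g| <= M.
Proof.
move=> bg gM; rewrite ler_norml -[- M]mean_cst -{2}[M]mean_cst; apply/andP; split;
  apply: le_mean => //; try exact: bounded_borel_cst;
  by move=> x /gM; rewrite ler_norml => /andP[].
Qed.

End BorelSphere.

(** * Variation of the energy *)

Section Variation.
Variables (R : realType) (d : nat) (q : R).
Hypothesis q0 : 0 < q.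
Local Notation V := 'rV[R]_d.
Local Notation D := (@unit_sphere R d).
Local Notation K := (@kernel_p R d q).
Variable mu : probability (borelRn R d) R.
Hypothesis muD : mu D = 1%E.
Local Notation mean := (mean mu).

(** The potential of the signed measure [f mu]. *)
Definition weighted_potential (f : V -> R) (y : V) : R := mean (fun x => K x y * f x).
Local Notation kmean := weighted_potential.

Lemma kernel_bounded_borel y : bounded_borel (K ^~ y).
Proof. by apply: bounded_borel_continuous; exact: kernel_continuous1. Qed.

Lemma kernel_weight_bounded f y : bounded_borel f -> bounded_borel (fun x => K x y * f x).
Proof. exact: bounded_borelM (kernel_bounded_borel y). Qed.

Lemma weighted_potential_continuous f : bounded_borel f -> continuous (kmean f).
Proof.
move=> bf y; have [_ [M fM]] := bf.
apply/(@cvgrPdist_le _ R^o _ _ (@nbhs_filter V y)) => e e0.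
have M1 : 0 < `|M| + 1 by rewrite ltr_wpDl.
have e1 : 0 < e / (`|M| + 1) by rewrite divr_gt0.
have := kernel_sphere_equicontinuous y q0 e1.
apply: (@filterS _ _ (@nbhs_filter V y)) => y' Hy'.
have -> : kmean f y - kmean f y' = mean (fun x => (K x y - K x y') * f x).
  rewrite -mulN1r -meanZ//; last exact: kernel_weight_bounded.
  rewrite -meanD//; try exact: bounded_borelZ (kernel_weight_bounded _ _); last exact: kernel_weight_bounded.
  by apply: eq_mean => x _; ring.
apply: norm_mean_le => //.
  apply: bounded_borelM => //; rewrite (_ : (fun _ => _) = fun x => K x y + (-1) * K x y').
    by apply: bounded_borelD; [|apply: bounded_borelZ]; exact: kernel_bounded_borel.
  by apply/funext => x; rewrite mulN1r.
move=> x Dx; rewrite normrM -[e](@divfK _ (`|M| + 1)) ?gt_eqF//.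
apply: ler_pM => //; first by apply/ltW/Hy'.
by apply: (le_trans (fM x Dx)); rewrite (le_trans (ler_norm _))// lerDl.
Qed.

Lemma weighted_potential_bounded f : bounded_borel f -> bounded_borel (kmean f).
Proof. by move=> bf; apply: bounded_borel_continuous; exact: weighted_potential_continuous. Qed.

(** The bilinear energy form at the signed measures [f mu] and [g mu]. *)
Definition mutual_energy (f g : V -> R) : R := mean (fun y => kmean f y * g y).
Local Notation B := mutual_energy.

Lemma weighted_potentialD f g y : bounded_borel f -> bounded_borel g ->
  kmean (fun x => f x + g x) y = kmean f y + kmean g y.
Proof.
move=> bf bg; rewrite /kmean -meanD//; try exact: kernel_weight_bounded.
by apply: eq_mean => x _; ring.
Qed.

Lemma weighted_potentialZ c f y : bounded_borel f -> kmean (fun x => c * f x) y = c * kmean f y.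
Proof.
move=> bf; rewrite /kmean -meanZ//; last exact: kernel_weight_bounded.
by apply: eq_mean => x _; ring.
Qed.

Lemma weighted_potential_sum I (r : seq I) (f : I -> V -> R) y : (forall i, bounded_borel (f i)) ->
  kmean (fun x => \sum_(i <- r) f i x) y = \sum_(i <- r) kmean (f i) y.
Proof.
move=> bf; rewrite /kmean -mean_sum//; last by move=> i; exact: kernel_weight_bounded.
by apply: eq_mean => x _; rewrite mulr_sumr.
Qed.

Lemma mutual_energyDl f f' g : bounded_borel f -> bounded_borel f' -> bounded_borel g ->
  B (fun x => f x + f' x) g = B f g + B f' g.
Proof.
move=> bf bf' bg; rewrite /B -meanD//; try by apply: bounded_borelM => //; exact: weighted_potential_bounded.
by apply: eq_mean => y _; rewrite weighted_potentialD// mulrDl.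
Qed.

Lemma mutual_energyDr f g g' : bounded_borel f -> bounded_borel g -> bounded_borel g' ->
  B f (fun x => g x + g' x) = B f g + B f g'.
Proof.
move=> bf bg bg'; rewrite /B -meanD//; try by apply: bounded_borelM => //; exact: weighted_potential_bounded.
by apply: eq_mean => y _; rewrite mulrDr.
Qed.

Lemma mutual_energyZl c f g : bounded_borel f -> bounded_borel g ->
  B (fun x => c * f x) g = c * B f g.
Proof.
move=> bf bg; rewrite /B -meanZ//; last by apply: bounded_borelM => //; exact: weighted_potential_bounded.
by apply: eq_mean => y _; rewrite weighted_potentialZ// mulrA.
Qed.

Lemma mutual_energyZr c f g : bounded_borel f -> bounded_borel g ->
  B f (fun x => c * g x) = c * B f g.
Proof.
move=> bf bg; rewrite /B -meanZ//; last by apply: bounded_borelM => //; exact: weighted_potential_bounded.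
by apply: eq_mean => y _; ring.
Qed.

Lemma mutual_energy_sum n (c : 'I_n -> R) (f : 'I_n -> V -> R) : (forall i, bounded_borel (f i)) ->
  B (fun x => \sum_i c i * f i x) (fun x => \sum_i c i * f i x) =
  \sum_i \sum_j c i * c j * B (f j) (f i).
Proof.
move=> bf.
have bcf i : bounded_borel (fun x => c i * f i x) by exact: bounded_borelZ.
have bs : bounded_borel (fun x => \sum_i c i * f i x).
  exact: (bounded_borel_sum _ (g := fun i x => c i * f i x)).
transitivity (mean (fun y => \sum_i \sum_j c i * c j * (kmean (f j) y * f i y))).
  apply: eq_mean => y _; rewrite weighted_potential_sum// mulrC big_distrlr /=.
  by apply: eq_bigr => i _; apply: eq_bigr => j _; rewrite weighted_potentialZ//; ring.
have bij i j : bounded_borel (fun y => c i * c j * (kmean (f j) y * f i y)).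
  by apply: bounded_borelZ; apply: bounded_borelM => //; exact: weighted_potential_bounded.
rewrite (mean_sum muD); last by move=> i; exact: bounded_borel_sum.
apply: eq_bigr => i _; rewrite (mean_sum muD); last by move=> j; exact: bij.
apply: eq_bigr => j _.
by rewrite meanZ//; apply: bounded_borelM => //; exact: weighted_potential_bounded.
Qed.

Lemma integral_kernel y :
  (\int[mu]_(x in (D : set (borelRn R d))) (K x y)%:E)%E = (kmean (fun=> 1) y)%:E.
Proof.
rewrite meanE//; last exact: kernel_bounded_borel.
by congr EFin; apply: eq_mean => x _; rewrite mulr1.
Qed.

Lemma potential_mean y : potential q mu y = (kmean (fun=> 1) y)%:E.
Proof. by rewrite -integral_kernel; apply: eq_integral => x _; rewrite kernel_pC. Qed.

Lemma energy_mean : energy q mu = (B (fun=> 1) (fun=> 1))%:E.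
Proof.
rewrite /energy -meanE//; last first.
  by apply: bounded_borelM; [apply: weighted_potential_bounded|]; exact: bounded_borel_cst.
by apply: eq_integral => y _; rewrite mulr1; exact: integral_kernel.
Qed.

Lemma density_energy w : bounded_borel w -> (forall x, D x -> 0 <= w x) -> mean w = 1 ->
  exists2 rho : probability (borelRn R d) R, @sphere_prob R d rho & energy q rho = (B w w)%:E.
Proof.
move=> bw w0 w1; have [mw _] := bw; have mD : measurable (D : set (borelRn R d)) by exact: sphere_borel.
(* Nonnegativity of [w] is known on the sphere only; the cut-off extends it without changing
   integrals over the sphere. *)
pose w' x := w x * \1_D x.
have w'E x : D x -> w' x = w x by move=> Dx; rewrite /w' indicE mem_set// mulr1.
have w'0 x : 0 <= w' x.
  rewrite /w' indicE; case: (boolP (x \in D)) => [/set_mem Dx|_]; rewrite ?mulr1 ?mulr0//; exact: w0.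
have mw' : measurable_fun [set: borelRn R d] (w' : borelRn R d -> R).
  by apply: measurable_funM => //; exact: measurable_indic.
have intD : (\int[mu]_(x in (D : set (borelRn R d))) (w' x)%:E = 1)%E.
  rewrite (_ : (1 = (mean w)%:E)%E); last by rewrite w1.
  by rewrite -meanE//; apply: eq_integral => x /set_mem Dx; rewrite w'E.
have int1 : (\int[mu]_x (w' x)%:E = 1)%E.
  rewrite -intD [RHS]integral_mkcond; apply: eq_integral => x _.
  rewrite /patch; case: ifPn => // xD; congr EFin.
  by rewrite /w' indicE (negbTE xD) mulr0.
have [rho [rhoE rhoI]] := density_probability mw' w'0 int1.
exists rho; first by rewrite /sphere_prob /= rhoE.
have inner (f : V -> R) : bounded_borel f -> (forall x, 0 <= f x) ->
    (\int[rho]_(x in (D : set (borelRn R d))) (f x)%:E = (mean (fun x => f x * w x))%:E)%E.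
  move=> bf f0; rewrite rhoI//; last by apply/measurable_EFinP/measurable_funTS; case: bf.
  rewrite -meanE//; last exact: bounded_borelM.
  by apply: eq_integral => x /set_mem Dx; rewrite w'E.
rewrite /mutual_energy -inner; last 2 first.
- exact: weighted_potential_bounded.
- move=> y; rewrite -[0](mean_cst muD); apply: le_mean => //.
  + exact: bounded_borel_cst.
  + exact: kernel_weight_bounded.
  + by move=> x Dx; rewrite mulr_ge0 ?kernel_p_ge0// w0.
apply: eq_integral => y _; rewrite inner//; first exact: kernel_bounded_borel.
by move=> x; exact: kernel_p_ge0.
Qed.

End Variation.

(** The signs [t = s] and [t = - s] together give a bound of the absolute value of [X] by [s * Y],
    for all small [s]. *)
Lemma small_perturbation (R : realType) (s0 X Y : R) : 0 < s0 ->
  (forall t, `|t| <= s0 -> 0 <= t * X + t ^+ 2 * Y) -> X = 0 /\ 0 <= Y.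
Proof.
move=> s0_gt0 h.
have pos s : 0 < s -> s <= s0 -> `|X| <= s * Y.
  move=> sp ss; have h1 := h s; have h2 := h (- s).
  rewrite ?normrN !gtr0_norm// in h1 h2.
  have {}h1 := h1 ss; have {}h2 := h2 ss.
  have {}h1 : 0 <= X + s * Y by rewrite -(pmulr_rge0 _ sp); move: h1; congr (0 <= _); ring.
  have {}h2 : 0 <= - X + s * Y by rewrite -(pmulr_rge0 _ sp); move: h2; congr (0 <= _); ring.
  by rewrite ler_norml; apply/andP; split; lra.
have Y0 : 0 <= Y.
  by rewrite -(pmulr_rge0 _ s0_gt0) (le_trans _ (pos s0 _ _)).
split => //; apply: contrapT => /eqP X0.
have X1 : 0 < `|X| by rewrite normr_gt0.
have sY : 0 <= s0 * Y by rewrite mulr_ge0// ltW.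
(* At [s = k * s0] the bound [s * Y] is [1 - k] times the absolute value of [X], which is too
   small. *)
pose k := `|X| / (`|X| + s0 * Y).
have den : 0 < `|X| + s0 * Y by rewrite ltr_pwDl.
have k0 : 0 < k by rewrite divr_gt0.
have k1 : k <= 1 by rewrite ler_pdivrMr// mul1r lerDl.
have h1 : k * s0 <= s0 by rewrite ler_piMl// ltW.
have h2 := pos (k * s0) (mulr_gt0 k0 s0_gt0) h1.
have h3 : k * (`|X| + s0 * Y) = `|X| by rewrite divfK// gt_eqF.
have := mulr_gt0 k0 X1; lra.
Qed.

Section Minimizer.
Variables (R : realType) (d : nat) (q : R).
Hypothesis q0 : 0 < q.
Local Notation V := 'rV[R]_d.
Local Notation D := (@unit_sphere R d).
Local Notation K := (@kernel_p R d q).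
Variable mu : probability (borelRn R d) R.
Hypothesis mu_min : minimizers q mu.
Local Notation mean := (mean mu).
Local Notation B := (mutual_energy q mu).
Local Notation kmean := (weighted_potential q mu).
Local Notation e := (B (fun=> 1) (fun=> 1)).

Lemma minimizer_sphere : mu D = 1%E. Proof. by case: mu_min. Qed.
Let muD := minimizer_sphere.

Lemma minimizer_energy_le (rho : probability (borelRn R d) R) x :
  @sphere_prob R d rho -> energy q rho = x%:E -> e <= x.
Proof.
move=> Drho rhoE; rewrite -lee_fin -rhoE -(energy_mean q0 muD).
case: mu_min => _ ->; apply: ereal_inf_lbound; by exists rho.
Qed.

(** Homogeneous form of minimality, obtained by normalizing [w] to a probability density; if [w] has
    mean zero, nonnegativity of the kernel suffices. *)
Lemma minimizer_density w : bounded_borel w -> (forall x, D x -> 0 <= w x) ->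
  e * mean w ^+ 2 <= B w w.
Proof.
move=> bw w0.
have [m0|mN0] := eqVneq (mean w) 0.
  rewrite m0 expr0n mulr0 -(mean_cst muD 0); apply: le_mean => //.
  - exact: bounded_borel_cst.
  - by apply: bounded_borelM => //; exact: weighted_potential_bounded.
  - move=> y Dy; apply: mulr_ge0; last exact: w0.
    rewrite -(mean_cst muD 0); apply: le_mean => //; first exact: bounded_borel_cst.
      exact: kernel_weight_bounded.
    by move=> x Dx; rewrite mulr_ge0 ?kernel_p_ge0// w0.
have m0 : 0 < mean w.
  rewrite lt0r mN0 -{1}(mean_cst muD 0) le_mean//; exact: bounded_borel_cst.
have bw' : bounded_borel (fun x => (mean w)^-1 * w x) by exact: bounded_borelZ.
have [||rho Drho] := density_energy q0 muD bw'.
- by move=> x Dx; rewrite mulr_ge0 ?invr_ge0 ?w0// ltW.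
- by rewrite meanZ// mulVf.
move=> /(minimizer_energy_le Drho); rewrite mutual_energyZl// mutual_energyZr// mulrA.
by rewrite -invfM mulrC ler_pdivlMr ?mulr_gt0// expr2.
Qed.

(** Minimality is applied to the densities [1 + t * g], nonnegative for small [t]. The linear term
    in [t] must vanish and the quadratic one is nonnegative; this bounds [B g g] below by
    [e * mean g ^+ 2], and [e >= 0]. *)
Lemma minimizer_variation g : bounded_borel g ->
  B (fun=> 1) g + B g (fun=> 1) = 2 * e * mean g /\ 0 <= B g g.
Proof.
move=> bg; have [_ [M gM]] := bg.
have b1 : @bounded_borel R d (fun=> 1) by exact: bounded_borel_cst.
have M1 : 0 < `|M| + 1 by rewrite ltr_wpDl.
have s0 : 0 < (`|M| + 1)^-1 by rewrite invr_gt0.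
set X := B (fun=> 1) g + B g (fun=> 1) - 2 * e * mean g.
have [|X0 Y0] := @small_perturbation R _ X (B g g - e * mean g ^+ 2) s0.
  move=> t ts.
  have btg : bounded_borel (fun x => t * g x) by exact: bounded_borelZ.
  have wtg x : D x -> 0 <= 1 + t * g x.
    move=> Dx; rewrite -[t * g x]opprK subr_ge0 -mulNr (le_trans (ler_norm _))//.
    rewrite normrM normrN -(@mulVf _ (`|M| + 1)) ?gt_eqF//; apply: ler_pM => //.
    by apply: (le_trans (gM x Dx)); rewrite (le_trans (ler_norm _))// lerDl.
  have := @minimizer_density (fun x => 1 + t * g x) (bounded_borelD b1 btg).
  rewrite meanD// meanZ// (mean_cst muD) mutual_energyDl//; last exact: bounded_borelD.
  rewrite !mutual_energyDr// !mutual_energyZl// ?mutual_energyZr//.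
  move=> h; have {}h := h wtg; move: h; rewrite /X.
  move: (B (fun=> 1) (fun=> 1)) (B (fun=> 1) g) (B g (fun=> 1)) (B g g) (mean g).
  move=> e1 e2 e3 e4 m; lra.
split; first by apply/eqP; rewrite -subr_eq0; apply/eqP.
move: Y0; rewrite subr_ge0; apply: le_trans.
rewrite mulr_ge0 ?sqr_ge0// -(mean_cst muD 0); apply: le_mean => //; first exact: bounded_borel_cst.
  by apply: bounded_borelM => //; exact: weighted_potential_bounded.
move=> y Dy; rewrite mulr1 -(mean_cst muD 0); apply: le_mean => //; first exact: bounded_borel_cst.
  exact: kernel_weight_bounded.
by move=> x Dx; rewrite mulr1 kernel_p_ge0.
Qed.

End Minimizer.

(** * Supports of minimizers *)

Section Support.
Variables (R : realType) (d : nat).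
Local Notation V := 'rV[R]_d.
Local Notation D := (@unit_sphere R d).
Variable mu : probability (borelRn R d) R.
Hypothesis muD : mu D = 1%E.
Local Notation mean := (mean mu).

Lemma sphere_compl_null : mu (~` D) = 0%E.
Proof. by rewrite [LHS]probability_setC ?[X in (1 - X)%E]muD ?subee//; exact: sphere_borel. Qed.

Lemma mean_indic (A : set V) : measurable (A : set (borelRn R d)) -> (mean (\1_A))%:E = mu A.
Proof.
move=> mA; rewrite -meanE//; last exact: bounded_borel_indic.
have mD : measurable (D : set (borelRn R d)) by exact: sphere_borel.
rewrite [LHS](integral_indic mu mD mA).
have -> : mu A = mu ((A `&` D) `|` (A `\` D)) by rewrite setUIDK.
rewrite measureU ?[X in (_ + X)%E](_ : _ = 0%E) ?adde0//.
- apply: (subset_measure0 _ _ _ sphere_compl_null).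
  + exact: measurableD.
  + exact: measurableC.
  + by move=> z [].
- exact: measurableI.
- exact: measurableD.
- by rewrite setDE setIACA setICr setI0.
Qed.

Lemma supp_sphere : supp mu `<=` D.
Proof.
move=> x Sx; apply: contrapT => nDx.
have : (0 < mu (~` D))%E by apply: Sx => //; rewrite openC; exact: sphere_closed.
by rewrite sphere_compl_null ltxx.
Qed.

Lemma supp_closed : closed (supp mu).
Proof.
move=> x clx U oU Ux.
have [y [Sy Uy]] : supp mu `&` U !=set0 by apply: clx; exact: open_nbhs_nbhs.
exact: Sy.
Qed.

(** Every point of the sphere outside [O] has a null open neighbourhood, and by compactness finitely
    many of them cover. *)
Lemma supp_nbhd_null (O : set V) : open O -> supp mu `<=` O -> mu (~` O) = 0%E.
Proof.
move=> oO suppO.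
have cDO : compact (D `\` O).
  apply: (subclosed_compact _ (@sphere_compact R d)); last by move=> z [].
  by rewrite setDE; apply: closedI; [exact: sphere_closed | rewrite closedC].
have /choice[N HN] : forall z : V, exists N : set V, (D `\` O) z -> [/\ open N, N z & mu N = 0%E].
  move=> z; have [[Dz Oz]|] := pselect ((D `\` O) z); last by exists set0.
  have : ~ supp mu z by move/suppO.
  move=> /existsNP[N /not_implyP[oN /not_implyP[Nz muN]]]; exists N => _; split => //.
  by apply/eqP; rewrite eq_le measure_ge0 leNgt andbT; apply/negP.
move: cDO; rewrite compact_cover => /(_ V (D `\` O) N)[||D' D'sub cov].
- by move=> z /HN[].
- by move=> z DOz; exists z => //; have [] := HN z DOz.
have mO : measurable (~` O : set (borelRn R d)) by apply: measurableC; exact: open_borel.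
apply: (measure_negligible mO).
apply: (@negligibleS _ _ _ mu (~` D `|` \big[setU/set0]_(z <- D') N z)).
  move=> z Oz; have [Dz|] := pselect (D z); last by left.
  by right; rewrite -bigcup_fset; exact: cov.
apply: negligibleU.
  by apply/negligibleP; [apply: measurableC; exact: sphere_borel | exact: sphere_compl_null].
rewrite big_seq_cond; apply: big_ind; first exact: negligible_set0.
  by move=> A B; exact: negligibleU.
move=> z /andP[/D'sub/set_mem DOz _]; have [oN _ N0] := HN z DOz.
by apply/negligibleP => //; exact: open_borel.
Qed.

Lemma supp_nonempty : supp mu !=set0.
Proof.
apply: contrapT => /set0P/negP/negPn/eqP S0.
have := @supp_nbhd_null set0 open0; rewrite S0 setC0 probability_setT => /(_ (fun _ => id))/eqP.
by rewrite onee_eq0.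
Qed.

(** By continuity [g > - eps] on an open set containing the support, whose complement is null; [g]
    is compared there with [delta * \1_N - eps]. *)
Lemma mean_ge_supp (g : V -> R) (N : set V) (delta : R) : continuous g ->
  measurable (N : set (borelRn R d)) -> 0 <= delta ->
  (forall z, supp mu z -> 0 <= g z) -> (forall z, N z -> delta <= g z) ->
  delta * mean (\1_N) <= mean g.
Proof.
move=> cg mN delta0 gS gN; apply/ler_addgt0Pr => eps eps0.
have bg : bounded_borel g by exact: bounded_borel_continuous.
have [_ [M gM]] := bg.
pose O := g @^-1` `]- eps, +oo[%classic.
have oO : open O by apply: open_comp; [move=> z _; exact: cg | exact: interval_open].
have suppO : supp mu `<=` O by move=> z /gS gz; rewrite /O /= in_itv/= andbT (lt_le_trans _ gz)// oppr_lt0.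
have mO : measurable (~` O : set (borelRn R d)) by apply: measurableC; exact: open_borel.
have nO : mean (\1_(~` O)) = 0.
  by have := mean_indic mO; rewrite supp_nbhd_null// => -[].
have bN : bounded_borel (\1_N : V -> R) by exact: bounded_borel_indic.
have bO : bounded_borel (\1_(~` O) : V -> R) by exact: bounded_borel_indic.
have be : bounded_borel (fun _ : V => - eps) by exact: bounded_borel_cst.
have bNd := bounded_borelZ delta bN; have bOd := bounded_borelZ (- (`|M| + delta)) bO.
have : mean (fun z => - eps + delta * \1_N z + - (`|M| + delta) * \1_(~` O) z) <= mean g.
  apply: le_mean => //; first by apply: bounded_borelD => //; exact: bounded_borelD.
  move=> z Dz; have gz := gM z Dz.
  have gz' : - `|M| <= g z.
    by rewrite lerNl (le_trans _ (le_trans gz (ler_norm M)))// -normrN ler_norm.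
  rewrite !indicE; case: (boolP (z \in ~` O)) => [_|]; rewrite ?mulr1 ?mulr0.
    case: (boolP (z \in N)) => _; rewrite ?mulr1 ?mulr0; lra.
  rewrite notin_setE /= => /contrapT; rewrite /O /= in_itv/= andbT => Oz.
  case: (boolP (z \in N)) => [/set_mem/gN Nz|_]; rewrite ?mulr1 ?mulr0; lra.
rewrite meanD//; last exact: bounded_borelD.
by rewrite meanD// !meanZ// nO (mean_cst muD) mulr0 addr0; lra.
Qed.

End Support.

Section MinimizerSupport.
Variables (R : realType) (d : nat) (q : R).
Hypothesis q0 : 0 < q.
Local Notation V := 'rV[R]_d.
Local Notation D := (@unit_sphere R d).
Local Notation K := (@kernel_p R d q).
Variable mu : probability (borelRn R d) R.
Hypothesis mu_min : minimizers q mu.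
Local Notation mean := (mean mu).
Local Notation B := (mutual_energy q mu).
Local Notation kmean := (weighted_potential q mu).
Local Notation e := (B (fun=> 1) (fun=> 1)).
Let muD := minimizer_sphere mu_min.

(** A probability density relative to [mu] that replaces the Dirac mass at [x], with error [eps]
    when integrated against the kernel. *)
Definition bump (x : V) (eps : R) (g : V -> R) : Prop :=
  [/\ bounded_borel g, forall z, 0 <= g z, mean g = 1 &
      forall z, g z != 0 -> forall u, D u -> `|K u x - K u z| < eps].

Lemma bump_exists x eps : supp mu x -> 0 < eps -> exists g, bump x eps g.
Proof.
move=> Sx eps0.
have : nbhs x [set z : V | forall u, D u -> `|K u x - K u z| < eps].
  exact: kernel_sphere_equicontinuous.
rewrite nbhsE => -[W [oW Wx] WK].
have mO : measurable (W : set (borelRn R d)) by exact: open_borel.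
have bO : bounded_borel (\1_W : V -> R) by exact: bounded_borel_indic.
have m0 : 0 < mean (\1_W) by rewrite -lte_fin mean_indic//; exact: Sx.
exists (fun z => (mean (\1_W))^-1 * \1_W z); split.
- exact: bounded_borelZ.
- by move=> z; rewrite mulr_ge0 ?invr_ge0 ?(ltW m0)// indicE; case: (_ \in _).
- by rewrite meanZ// mulVf// gt_eqF.
- move=> z; rewrite indicE; case: (boolP (z \in W)) => [/set_mem Oz _ |]; first exact: WK.
  by rewrite mulr0 eqxx.
Qed.

Lemma bump_mean x eps g h c r : bump x eps g -> bounded_borel h ->
  (forall z, D z -> g z != 0 -> `|h z - c| <= r) -> `|mean (fun z => h z * g z) - c| <= r.
Proof.
move=> [bg g0 g1 _] bh hr.
have bc : bounded_borel (fun _ : V => - c) by exact: bounded_borel_cst.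
have brg := bounded_borelZ r bg.
have bhc := bounded_borelM (bounded_borelD bh bc) bg.
have -> : mean (fun z => h z * g z) - c = mean (fun z => (h z + - c) * g z).
  have bcg := bounded_borelZ (- c) bg.
  rewrite -[X in _ - X]mulr1 -{1}g1 -mulNr -meanZ// -meanD//; last exact: bounded_borelM.
  by apply: eq_mean => z _; rewrite mulrDl.
have main z : D z -> `|(h z + - c) * g z| <= r * g z.
  move=> Dz; have [->|gz] := eqVneq (g z) 0; first by rewrite !mulr0 normr0.
  by rewrite normrM [X in _ * X]ger0_norm// ler_wpM2r// hr.
have -> : r = mean (fun z => r * g z) by rewrite meanZ// g1 mulr1.
rewrite ler_norml; apply/andP; split.
  rewrite -mulN1r -meanZ//; apply: le_mean => //; first exact: bounded_borelZ.
  by move=> z /main; rewrite mulN1r ler_norml => /andP[].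
by apply: le_mean => // z /main; rewrite ler_norml => /andP[].
Qed.

Lemma bump_potential x eps g y : bump x eps g -> D y -> `|kmean g y - K x y| <= eps.
Proof.
move=> bx Dy; apply: (bump_mean bx); first exact: kernel_bounded_borel.
move=> z Dz gz; case: bx => _ _ _ /(_ z gz y Dy).
by rewrite distrC ![K y _]kernel_pC => /ltW.
Qed.

Lemma bump_mutual_energy x x' eps g g' : D x -> bump x eps g -> bump x' eps g' ->
  `|B g g' - K x x'| <= 2 * eps.
Proof.
move=> Dx bx bx'; have [bg _ _ _] := bx.
apply: (bump_mean bx'); first exact: weighted_potential_bounded.
move=> z Dz gz; rewrite (le_trans (ler_distD (K x z) _ _))//.
rewrite mulr_natl mulr2n lerD//; first exact: bump_potential bx Dz.
by case: bx' => _ _ _ /(_ z gz x Dx); rewrite distrC => /ltW.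
Qed.

(** For a bump [g] at [x], both terms of the first variation are within [eps] of the potential at
    [x], and their sum is [2 * e]. *)
Lemma minimizer_potential x : supp mu x -> kmean (fun=> 1) x = e.
Proof.
move=> Sx; have Dx := supp_sphere muD Sx.
have b1 : @bounded_borel R d (fun=> 1) by exact: bounded_borel_cst.
apply/eqP; rewrite -subr_eq0 -normr_le0; apply/ler_addgt0Pr => eps eps0; rewrite add0r.
have [g bx] := bump_exists Sx eps0; have [bg g0 g1 gK] := bx.
have [E1 _] := minimizer_variation q0 mu_min bg; rewrite g1 mulr1 in E1.
have potE z : kmean (fun=> 1) z = mean (K ^~ z) by apply: eq_mean => u _; exact: mulr1.
have h1 : `|B (fun=> 1) g - kmean (fun=> 1) x| <= eps.
  apply: (bump_mean bx (weighted_potential_bounded q0 muD b1)) => z Dz gz.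
  rewrite distrC !potE -(meanB _ (kernel_bounded_borel q0 x) (kernel_bounded_borel q0 z)).
  apply: (norm_mean_le muD (bounded_borelB (kernel_bounded_borel q0 x) (kernel_bounded_borel q0 z))).
  by move=> u Du; apply/ltW/gK.
have h2 : `|B g (fun=> 1) - kmean (fun=> 1) x| <= eps.
  have bk := weighted_potential_bounded q0 muD bg.
  have -> : B g (fun=> 1) = mean (kmean g) by apply: eq_mean => y _; exact: mulr1.
  rewrite potE -(meanB _ bk (kernel_bounded_borel q0 x)).
  apply: (norm_mean_le muD (bounded_borelB bk (kernel_bounded_borel q0 x))) => y Dy.
  by rewrite (kernel_pC q y x); exact: bump_potential bx Dy.
move: E1 h1 h2; rewrite !ler_norml.
move: (B (fun=> 1) g) (B g (fun=> 1)) (B (fun=> 1) (fun=> 1)) (kmean (fun=> 1) x).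
move=> a1 a2 a3 a4 E1 /andP[h1 h2] /andP[h3 h4]; apply/andP; split; lra.
Qed.

(** The second variation is nonnegative at combinations of bumps, whose mutual energies approximate
    the values of the kernel. *)
Lemma minimizer_psd : psd_kernel_on (supp mu) K.
Proof.
split=> [x y _ _|n x c Sx]; first exact: kernel_pC.
set Q := \sum_(i < n) _; pose C := \sum_i \sum_j `|c i * c j|.
have C0 : 0 <= C by apply: sumr_ge0 => i _; apply: sumr_ge0.
rewrite -oppr_le0; apply/ler_addgt0Pr => eps eps0; rewrite add0r.
(* Each mutual energy has error at most [2 * r], so the total error is at most
   [C * (2 * r) <= eps]. *)
pose r := eps / (2 * (C + 1)).
have C1 : 0 < 2 * (C + 1) by rewrite mulr_gt0// ltr_wpDl.
have r0 : 0 < r by rewrite divr_gt0.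
have /choice[g bx] := fun i => bump_exists (Sx i) r0.
have bg i : bounded_borel (g i) by case: (bx i).
have bcg : bounded_borel (fun z => \sum_i c i * g i z).
  by apply: (bounded_borel_sum _ (g := fun i z => c i * g i z)) => i; exact: bounded_borelZ.
have [_] := minimizer_variation q0 mu_min bcg.
rewrite mutual_energy_sum// => BE.
have : \sum_i \sum_j c i * c j * B (g j) (g i) - Q <= C * (2 * r).
  rewrite /Q /C -sumrB mulr_suml; apply: ler_sum => i _.
  rewrite -sumrB mulr_suml; apply: ler_sum => j _; rewrite -mulrBr.
  apply: (le_trans (ler_norm _)); rewrite normrM ler_wpM2l//.
  rewrite [K (x i) (x j)]kernel_pC; apply: bump_mutual_energy => //.
  exact: (supp_sphere muD (Sx j)).
have -> : C * (2 * r) = eps * (C / (C + 1)).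
  by rewrite /r; field; rewrite gt_eqF// ltr_wpDl.
have : eps * (C / (C + 1)) <= eps.
  by rewrite ler_piMr ?(ltW eps0)// ler_pdivrMr ?ltr_wpDl// mul1r lerDl.
lra.
Qed.

End MinimizerSupport.

(** * Optimal finite configurations *)

Lemma matrix_entry_continuous (T : topologicalType) m n (i : 'I_m) (j : 'I_n) :
  continuous (fun M : 'M[T]_(m, n) => M i j).
Proof.
move=> M A nA; exists (fun i' j' => if (i' == i) && (j' == j) then A else setT).
  by move=> i' j'; case: ifP => [/andP[/eqP -> /eqP ->]//|_]; exact: filterT.
by move=> N /= /(_ i j); rewrite !eqxx.
Qed.

Section OptimalConfiguration.
Variables (R : realType) (d N : nat) (q : R).
Hypothesis q0 : 0 < q.
Local Notation V := 'rV[R]_d.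
Local Notation D := (@unit_sphere R d).
Local Notation K := (@kernel_p R d q).
Variable S : set V.
Hypotheses (N0 : (0 < N)%N) (SD : S `<=` D) (cS : compact S) (S0 : S !=set0).
Hypothesis psdK : psd_kernel_on S K.
Hypothesis degenerate : forall x : 'I_N.+1 -> V, (forall i, S (x i)) ->
  exists2 c, (exists i, c i != 0) & qform (fun i j => K (x i) (x j)) c = 0.

Let config := ('rV[R]_N.+1 * 'rV[V]_N.+1)%type.
Let wt (v : config) i : R := v.1 ord0 i.
Let pt (v : config) i : V := v.2 ord0 i.
Let en (v : config) : R := qform (fun i j => K (pt v i) (pt v j)) (wt v).

Let wt_continuous i : continuous (fun v => wt v i).
Proof.
move=> v; apply: (@continuous_comp _ _ _ fst (fun u : 'rV[R]_N.+1 => u ord0 i)).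
  exact: cvg_fst.
exact: matrix_entry_continuous.
Qed.

Let pt_continuous i : continuous (fun v => pt v i).
Proof.
move=> v; apply: (@continuous_comp _ _ _ snd (fun u : 'rV[V]_N.+1 => u ord0 i)).
  exact: cvg_snd.
exact: matrix_entry_continuous.
Qed.

Let en_continuous : continuous en.
Proof.
have cM (f g : config -> R) : continuous f -> continuous g -> continuous (fun v => f v * g v).
  by move=> cf cg v; exact: (@cvgM R _ _ _ _ _ _ _ (cf v) (cg v)).
have c i j : continuous (fun v => wt v i * wt v j * K (pt v i) (pt v j)).
  apply: (cM _ _); first by apply: (cM _ _); exact: wt_continuous.
  move=> v; apply: (@continuous_comp _ _ _ (fun v => (pt v i, pt v j)) (fun z : V * V => K z.1 z.2)).
    by apply: (@cvg_pair _ _ _ (nbhs v) (nbhs (pt v i)) (nbhs (pt v j))); exact: pt_continuous.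
  exact: kernel_continuous.
have ci i : continuous (fun v => \sum_j wt v i * wt v j * K (pt v i) (pt v j)).
  by apply: sum_continuous => j _; exact: c.
by apply: sum_continuous => i _; exact: ci.
Qed.

Let prod_continuous : continuous (fun v => \prod_i wt v i).
Proof.
apply: continuous_big => [z|i _]; last exact: wt_continuous.
by apply: (@cvgM R); [exact: cvg_fst | exact: cvg_snd].
Qed.

(* Vanishing of the product of the weights leaves a free slot for a new point. *)
Let C := [set v : config | [/\ forall i, 0 <= wt v i <= 1 /\ S (pt v i),
  \sum_i wt v i = 1 & \prod_i wt v i = 0]].

Let C_compact : compact C.
Proof.
have -> : C = ([set u : 'rV[R]_N.+1 | forall i, `[(0 : R), 1]%classic (u ord0 i)] `*`
      [set x : 'rV[V]_N.+1 | forall i, S (x ord0 i)]) `&`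
    ((fun v => \sum_i wt v i) @^-1` [set 1] `&` (fun v => \prod_i wt v i) @^-1` [set 0]).
  apply/seteqP; split => v /=.
    by move=> [h1 h2 h3]; split => //; split => i; have [? ?] := h1 i => //=; rewrite in_itv.
  move=> [[h0 h1] [h2 h3]]; split => // i; split; last exact: h1.
  by have /= := h0 i; rewrite in_itv.
apply: compact_closedI.
  apply: compact_setX; last exact: (@rV_compact _ N.+1 (fun=> S) (fun=> cS)).
  by apply: (@rV_compact R N.+1 (fun=> `[(0 : R), 1]%classic)) => _; exact: segment_compact.
apply: closedI.
  apply: closed_comp; last exact: closed_eq.
  have cs : continuous (fun v => \sum_i wt v i).
    by apply: sum_continuous => i _; exact: (@wt_continuous i).
  by move=> v _; exact: cs.
by apply: closed_comp; [move=> v _; exact: prod_continuous | exact: closed_eq].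
Qed.

Let C_nonempty : C !=set0.
Proof.
have [s Ss] := S0.
exists (\row_i (i == ord0)%:R, const_mx s).
have wE i : wt (\row_i (i == ord0)%:R, const_mx s) i = (i == ord0)%:R by rewrite /wt mxE.
split.
- move=> i; rewrite wE /pt mxE /=; split => //.
  by case: (i == ord0); rewrite ?lexx ?ler01.
- under eq_bigr do rewrite wE; rewrite (bigD1 ord0)//= big1 ?addr0// => i /negbTE -> //.
(* As [N > 0], the last slot differs from the first and has weight zero. *)
- rewrite (bigD1 ord_max)//= wE (_ : _ == _ = false) ?mul0r//.
  by apply/negP => /eqP /(congr1 val) /= h; move: N0; rewrite h.
Qed.

Lemma config_in (w : 'I_N.+1 -> R) (x : 'I_N.+1 -> V) : (forall i, 0 <= w i) ->
  \sum_i w i = 1 -> (exists i, w i = 0) -> (forall i, S (x i)) ->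
  C (\row_i w i, \row_i x i) /\ en (\row_i w i, \row_i x i) = qform (fun i j => K (x i) (x j)) w.
Proof.
move=> w0 w1 [i0 wi0] Sx; split; last first.
  by apply: eq_bigr => i _; apply: eq_bigr => j _; rewrite /wt /pt !mxE.
split.
- move=> i; rewrite /wt /pt !mxE; split => //; rewrite w0 -w1 /=.
  by rewrite (bigD1 i)//= lerDl sumr_ge0.
- by rewrite -[RHS]w1; apply: eq_bigr => i _; rewrite /wt mxE.
- by rewrite (bigD1 i0)//= /wt mxE /= wi0 mul0r.
Qed.

(** A configuration of least energy [E] in [C] is perturbed by giving a small weight [t] to [y] in a
    free slot. The energy does not drop, and its derivative at [t = 0] is [2 * (F - E)]. *)
Lemma optimal_configuration : exists (w : 'I_N.+1 -> R) (x : 'I_N.+1 -> V),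
  [/\ forall i, 0 <= w i, \sum_i w i = 1, exists i, w i = 0, forall i, S (x i) &
    forall y, S y -> qform (fun i j => K (x i) (x j)) w <= \sum_j w j * K y (x j)].
Proof.
have en_within : {within C, continuous en}.
  by apply: continuous_subspaceT => v; exact: en_continuous.
have [v /set_mem[vwS v1 vp] minv] := compact_EVT_min C_nonempty C_compact en_within.
have [i0 wi0] : exists i, wt v i = 0.
  by move/eqP: vp; rewrite prodf_seq_eq0 => /hasP[i _ /= /eqP]; exists i.
have w0 i : 0 <= wt v i by have [/andP[]] := vwS i.
have Sx i : S (pt v i) by have [] := vwS i.
exists (wt v), (pt v); split => //; first by exists i0.
move=> y Sy; set E := qform _ _; set F := \sum_j _.
(* The free slot has weight zero, so the old weights do not see the new point. *)
pose x' i := if i == i0 then y else pt v i.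
have Sx' i : S (x' i) by rewrite /x'; case: ifP.
pose G' i j := K (x' i) (x' j).
have wx' (f : V -> R) i : wt v i * f (x' i) = wt v i * f (pt v i).
  by rewrite /x'; case: eqP => // ->; rewrite wi0 !mul0r.
have Q t : 0 <= t -> t <= 1 -> E <= (1 - t) ^+ 2 * E + 2 * (t * (1 - t)) * F + t ^+ 2.
  move=> t0 t1; pose w i := (1 - t) * wt v i + t * (i == i0)%:R.
  have delta (f : 'I_N.+1 -> R) : \sum_i (i == i0)%:R * f i = f i0.
    rewrite (bigD1 i0)//= eqxx mul1r big1 ?addr0// => i /negbTE ->; exact: mul0r.
  have -> : (1 - t) ^+ 2 * E + 2 * (t * (1 - t)) * F + t ^+ 2 = qform G' w.
    have e1 : \sum_i \sum_j wt v i * wt v j * G' i j = E.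
      apply: eq_bigr => i _; apply: eq_bigr => j _.
      rewrite -mulrA (wx' (fun z => K (x' i) z)) mulrCA (wx' (fun z => K z (pt v j))); ring.
    have e2 : \sum_j wt v j * G' i0 j = F.
      by apply: eq_bigr => j _; rewrite /G' (wx' (fun z => K (x' i0) z)) /x' eqxx.
    have e3 : G' i0 i0 = 1 by rewrite /G' /x' eqxx kernel_p_diag//; exact: SD.
    have e4 i : \sum_j w j * G' i j = (1 - t) * (\sum_j wt v j * G' i j) + t * G' i i0.
      rewrite -(delta (G' i)) !mulr_sumr -big_split; apply: eq_bigr => j _ /=; rewrite /w; ring.
    transitivity (\sum_i w i * \sum_j w j * G' i j); last first.
      by apply: eq_bigr => i _; rewrite mulr_sumr; apply: eq_bigr => j _; rewrite mulrA.
    transitivity ((1 - t) * (\sum_i wt v i * \sum_j w j * G' i j) + t * \sum_j w j * G' i0 j); last first.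
      rewrite -(delta (fun i => \sum_j w j * G' i j)) !mulr_sumr -big_split.
      by apply: eq_bigr => i _; rewrite /= /w; ring.
    under eq_bigr do rewrite e4 mulrDr mulrCA.
    rewrite big_split /= -mulr_sumr e4 e2 e3.
    have -> : \sum_i wt v i * \sum_j wt v j * G' i j = E.
      rewrite -e1; apply: eq_bigr => i _; rewrite mulr_sumr; apply: eq_bigr => j _; ring.
    have -> : \sum_i wt v i * (t * G' i i0) = t * F.
      by rewrite -e2 mulr_sumr; apply: eq_bigr => i _; rewrite /G' kernel_pC; ring.
    ring.
  (* The new configuration may occupy all slots; a null vector of its Gram matrix empties one
     without raising the energy, which leads back into [C]. *)
  have [c c0 Qc] := degenerate Sx'.
  have null i : \sum_j c j * G' i j = 0 by apply: (psd_null psdK Sx' Qc).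
  have wpos i : 0 <= w i by rewrite addr_ge0// mulr_ge0// subr_ge0.
  have wsum : \sum_i w i = 1.
    have := delta (fun=> 1); under eq_bigr do rewrite mulr1; move=> d1.
    by rewrite big_split /= -!mulr_sumr v1 d1 !mulr1 subrK.
  have symG' i j : G' i j = G' j i by exact: kernel_pC.
  have psdG' c' : 0 <= qform G' c' by exact: psd_qform psdK _ _ _ Sx'.
  have G'0 i j : 0 <= G' i j by exact: kernel_p_ge0.
  have G'd i : 0 < G' i i by rewrite /G' kernel_p_diag//; exact: SD.
  have [w' [w'0 w'1 w'z w'le]] := simplex_reduction symG' psdG' G'0 G'd c0 null wpos wsum.
  have [Cv' env'] := config_in w'0 w'1 w'z Sx'.
  by apply: le_trans w'le; rewrite -env'; apply: minv; exact/mem_set.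
rewrite leNgt; apply/negP => FE.
have d0 : 0 < E - F by rewrite subr_gt0.
set c := E - 2 * F + 1.
have den : 0 < `|c| + (E - F) by rewrite ltr_wpDl.
(* Small enough that [t * c < E - F], whereas [Q] requires [t * c >= 2 * (E - F)]. *)
pose t := (E - F) / (`|c| + (E - F)).
have t0 : 0 < t by rewrite divr_gt0.
have t1 : t <= 1 by rewrite ler_pdivrMr// mul1r lerDr.
have tE : t * (`|c| + (E - F)) = E - F by rewrite divfK// gt_eqF.
have := Q t (ltW t0) t1; rewrite -subr_ge0.
have -> : (1 - t) ^+ 2 * E + 2 * (t * (1 - t)) * F + t ^+ 2 - E = t * (t * c - 2 * (E - F)).
  by rewrite /c; ring.
rewrite pmulr_rge0// subr_ge0 => h.
have h1 : t * c <= t * `|c| by rewrite ler_pM2l// ler_norm.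
have h2 : 0 < t * (E - F) by rewrite mulr_gt0.
lra.
Qed.

End OptimalConfiguration.

(** * Discrete measures and the sparse minimizer *)

Section DiscreteMeasure.
Context {disp : measure_display} {T : measurableType disp} {R : realType}.
Variables (N : nat) (w : 'I_N.+1 -> R) (x : 'I_N.+1 -> T).
Hypotheses (w0 : forall i, 0 <= w i) (w1 : \sum_i w i = 1).

Let atom (k : nat) : {measure set T -> \bar R} :=
  mscale (NngNum (w0 (inord k))) (dirac (x (inord k))).

Definition discrete_measure (_ : \sum_i w i = 1) : set T -> \bar R := msum atom N.+1.

HB.instance Definition _ := Measure.on (discrete_measure w1).

Let discrete_measureE A : discrete_measure w1 A = (\sum_i (w i * \1_A (x i))%:E)%E.
Proof.
by apply: eq_bigr => i _; rewrite /atom /= /mscale /= inord_val /dirac -EFinM.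
Qed.

Let discrete_measure1 : discrete_measure w1 setT = 1%E.
Proof.
rewrite discrete_measureE sumEFin -[in RHS]w1; congr EFin.
by apply: eq_bigr => i _; rewrite indicT mulr1.
Qed.

HB.instance Definition _ := Measure_isProbability.Build _ _ _ (discrete_measure w1) discrete_measure1.

Lemma discrete_probability : exists rho : probability T R,
  (forall A, rho A = (\sum_i (w i * \1_A (x i))%:E)%E) /\
  forall (f : T -> R) E, measurable E -> (forall i, E (x i)) ->
    (forall z, 0 <= f z) -> measurable_fun E f ->
    (\int[rho]_(z in E) (f z)%:E = (\sum_i w i * f (x i))%:E)%E.
Proof.
exists (discrete_measure w1); split; first exact: discrete_measureE.
move=> f E mE Ex f0 mf; have mf' : measurable_fun E (EFin \o f) by exact/measurable_EFinP.
rewrite (@ge0_integral_measure_sum _ _ _ atom E mE (EFin \o f)) //; last first.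
  by move=> z _; rewrite lee_fin.
rewrite -sumEFin; apply: eq_bigr => i _.
rewrite ge0_integral_mscale//; last by move=> z _; rewrite lee_fin.
by rewrite integral_dirac//= inord_val /dirac indicE mem_set// mul1e -EFinM.
Qed.

End DiscreteMeasure.

Section SparseMinimizer.
Variables (R : realType) (d N : nat) (q : R).
Hypotheses (q0 : 0 < q) (N0 : (0 < N)%N).
Local Notation V := 'rV[R]_d.
Local Notation D := (@unit_sphere R d).
Local Notation K := (@kernel_p R d q).
Variable mu : probability (borelRn R d) R.
Hypothesis mu_min : minimizers q mu.
Hypothesis degenerate : forall x : 'I_N.+1 -> V, (forall i, supp mu (x i)) ->
  exists2 c, (exists i, c i != 0) & qform (fun i j => K (x i) (x j)) c = 0.
Local Notation e := (mutual_energy q mu (fun=> 1) (fun=> 1)).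
Local Notation F := (weighted_potential q mu (fun=> 1)).
Let muD := minimizer_sphere mu_min.

(** The measure [nu] is the optimal configuration, with potential [g >= E] on the support of [mu].
    By symmetry the [mu]-mean of [g] averages the potential of [mu] at the points [x i], which is
    [e]. So [E = e], and [g - e], nonnegative on the support with mean zero, vanishes there by
    continuity. *)
Lemma sparse_minimizer : exists nu : probability (borelRn R d) R,
  [/\ minimizers q nu, supp nu `<=` supp mu, (supp nu #<= `I_N)%card &
      forall x, supp mu x -> potential q mu x = potential q nu x].
Proof.
have cS : compact (supp mu).
  apply: (subclosed_compact _ (@sphere_compact R d)); first exact: supp_closed.
  exact: supp_sphere.
have [w [x [w0 w1 [i0 wi0] Sx opt]]] := optimal_configuration q0 N0 (supp_sphere muD)
  cS (supp_nonempty muD) (minimizer_psd q0 mu_min) degenerate.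
set E := qform _ _ in opt.
have Dx i : D (x i) by apply: (supp_sphere muD).
have mD : measurable (D : set (borelRn R d)) by exact: sphere_borel.
have [nu [nuE nuI]] := @discrete_probability _ (borelRn R d) R N w x w0 w1.
have nu_int (f : V -> R) : continuous f -> (forall z, 0 <= f z) ->
    (\int[nu]_(z in (D : set (borelRn R d))) (f z)%:E = (\sum_i w i * f (x i))%:E)%E.
  by move=> cf f0; apply: nuI => //; apply: measurable_funTS; exact: continuous_borel.
pose g z := \sum_i w i * K z (x i).
have nu_pot z : potential q nu z = (g z)%:E.
  rewrite /potential (nu_int (fun y => K z y)).
  - by [].
  - rewrite (_ : (fun y => K z y) = fun y => K y z); last by apply/funext => y; exact: kernel_pC.
    exact: kernel_continuous1.
  - by move=> y; exact: kernel_p_ge0.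
have cg : continuous g.
  apply: sum_continuous => i _; have ck : continuous (fun z => K z (x i)) by exact: kernel_continuous1.
  by move=> z; exact: (@cvgM R _ _ _ _ _ _ _ (@cvg_cst _ (w i) _ _ _) (ck z)).
have g0 z : 0 <= g z by apply: sumr_ge0 => i _; rewrite mulr_ge0// kernel_p_ge0.
have nuD : @sphere_prob R d nu.
  rewrite /sphere_prob /= nuE sumEFin -[in RHS]w1; congr EFin; apply: eq_bigr => i _.
  by rewrite indicE mem_set// mulr1.
have nu_energy : energy q nu = E%:E.
  rewrite /energy; transitivity (\int[nu]_(y in (D : set (borelRn R d))) (g y)%:E)%E.
    apply: eq_integral => y _; rewrite -nu_pot /potential; apply: eq_integral => z _.
    by rewrite kernel_pC.
  rewrite nu_int//; congr EFin; apply: eq_bigr => i _; rewrite mulr_sumr.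
  by apply: eq_bigr => j _; rewrite mulrA.
have eE : e <= E := minimizer_energy_le q0 mu_min nuD nu_energy.
have bK i : bounded_borel (fun z => K z (x i)) by exact: kernel_bounded_borel.
have mean_g : mean mu g = e.
  rewrite /g (mean_sum muD) => [|i]; last exact: bounded_borelZ.
  transitivity (\sum_i w i * e); last by rewrite -mulr_suml w1 mul1r.
  apply: eq_bigr => i _; rewrite meanZ//; congr (_ * _).
  by rewrite -(minimizer_potential q0 mu_min (Sx i)); apply: eq_mean => z _; rewrite mulr1.
have bg : bounded_borel g by exact: bounded_borel_continuous.
have cge (c : R) : continuous (fun z => g z + c).
  by move=> z; exact: (@cvgD _ R^o _ _ _ _ _ _ _ (cg z) (@cvg_cst _ c _ _ _)).
have mean_gc c : mean mu (fun z => g z + c) = e + c.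
  by rewrite meanD//; [rewrite mean_g (mean_cst muD)|exact: bounded_borel_cst].
have gS z : supp mu z -> E <= g z by move=> /opt; rewrite /g.
have Ee : E = e.
  apply/eqP; rewrite eq_le eE andbT -subr_ge0 -(mean_gc (- E)).
  rewrite -[leLHS](mul0r (mean mu (\1_(set0)))).
  by apply: (mean_ge_supp muD (cge (- E))) => // z Sz; rewrite subr_ge0 gS.
(* Leaving out the empty slot [i0] brings the number of points from [N.+1] down to [N]. *)
pose P := [set x j | j in [set j | j != i0]].
have nuP : supp nu `<=` P.
  move=> z Sz; apply: contrapT => Pz.
  have oP : open (~` P).
    rewrite openC; have /accessible_finite_set_closed clf : accessible_space V.
      by apply: hausdorff_accessible; exact: norm_hausdorff.
    by apply: clf; apply: finite_image; exact: finite_finset.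
  have := Sz _ oP Pz; rewrite nuE big1 ?ltxx// => i _; congr EFin.
  have [->|ii0] := eqVneq i i0; first by rewrite wi0 mul0r.
  have Pi : P (x i) by exists i.
  by rewrite indicE memNset ?mulr0// => /(_ Pi).
exists nu; split.
- by split => //; case: mu_min => _ <-; rewrite nu_energy Ee (energy_mean q0 muD).
- by move=> z /nuP[j _ <-].
- apply: card_le_trans (subset_card_le nuP) _.
  case: N N0 w x i0 @P {Sx opt E Dx nuE nuI nu_int g nu_pot cg g0 nuD nu_energy eE bK mean_g bg cge mean_gc gS Ee nuP wi0 w0 w1} => // n _ w x i0 P.
  apply: (card_le_trans (subset_card_le _) (card_image_le (fun k => x (lift i0 (inord k))) `I_n.+1)).
  move=> _ [j /= ji0 <-]; have [k -> _] := unlift_some (ltac:(by rewrite eq_sym) : i0 != j).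
  by exists k; rewrite /= ?ltn_ord// inord_val.
- move=> z Sz; rewrite nu_pot (potential_mean q0 mu) (minimizer_potential q0 mu_min Sz).
  congr EFin; apply/eqP; rewrite eq_le -{1}Ee gS//= leNgt; apply/negP => ez.
  (* If [g z > e], then [g] exceeds [e + delta] on a neighbourhood of [z] of positive mass, which
     would push its mean above [e]. *)
  pose delta := (g z - e) / 2.
  have d0 : 0 < delta by rewrite divr_gt0// subr_gt0.
  pose W := g @^-1` `]e + delta, +oo[%classic.
  have oW : open W by apply: open_comp; [move=> u _; exact: cg | exact: interval_open].
  have Wz : W z by rewrite /W /= in_itv/= andbT /delta; lra.
  have mW : measurable (W : set (borelRn R d)) by exact: open_borel.
  have muW : 0 < mean mu (\1_W) by rewrite -lte_fin (mean_indic muD)//; exact: Sz.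
  have : delta * mean mu (\1_W) <= mean mu (fun u => g u + - e).
    apply: (mean_ge_supp muD (cge (- e)) mW (ltW d0)).
    + by move=> u Su; rewrite subr_ge0 -Ee gS.
    + by move=> u; rewrite /W /= in_itv/= andbT; lra.
  by rewrite mean_gc subrr leNgt mulr_gt0.
Qed.

End SparseMinimizer.

Theorem theorem1p1 (R : realType) (d a b : nat)
    (hd : (2 <= d)%N) (ha : (0 < a)%N) (hb : (0 < b)%N) (hab : coprime a b) :
  let p : R := a%:R / b%:R in
  (forall mu : probability (borelRn R d) R, minimizers p mu ->
     exists nu : probability (borelRn R d) R,
       [/\ minimizers p nu,
           supp nu `<=` supp mu,
           (supp nu #<= `I_(bound_R d a))%card &
           forall x : 'rV[R]_d, supp mu x -> potential p mu x = potential p nu x])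
  /\
  ((forall S : set 'rV[R]_d,
      S `<=` @unit_sphere R d -> infinite_set S -> compact S ->
      psd_kernel_on S (@kernel_p R d p) -> (b < d)%N)
   /\
   ((d <= b)%N ->
      forall mu : probability (borelRn R d) R, minimizers p mu ->
        finite_set (supp mu))).
Proof.
move=> p; have d0 : (0 < d)%N by exact: ltnW.
have p0 : 0 < p by rewrite divr_gt0 ?ltr0n.
split; [|split].
- move=> mu mu_min; apply: (sparse_minimizer p0 _ mu_min).
    by rewrite /bound_R /dim_D; case: ifP => _; rewrite bin_gt0; lia.
  move=> x Sx; apply: (root_kernel_degenerate d0 hb _ (minimizer_psd p0 mu_min)) Sx => //.
  exact: supp_sphere (minimizer_sphere mu_min).
- move=> S SD infS _; exact: infinite_psd_root_kernel.
- move=> db mu mu_min; apply: contrapT => infS.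
  have := infinite_psd_root_kernel d0 ha hb hab (supp_sphere (minimizer_sphere mu_min)) infS
    (minimizer_psd p0 mu_min).
  by rewrite ltnNge db.
Qed.
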